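(* Let $n \geq 1$ be an integer and let $p$ be a real number with $1 < p < p_*$. Set $\beta = \frac{1}{p-1}$. If $u \geq 0$ is a classical solution on $\mathbb{R}^n$ of $$\Delta u - \frac{1}{2}\, x \cdot \nabla u + |u|^{p-1} u - \beta u = 0, \qquad x \in \mathbb{R}^n,$$ then $|\nabla u| \equiv 0$ on $\mathbb{R}^n$.
   Context: The exponent $p_*$ is defined by $p_* = \infty$ if $1 \leq n \leq 2$, and $p_* = \frac{n+2}{n-2}$ if $n \geq 3$. No boundedness of $u$ is assumed. *)

(* Defs.v *)
From HB Require Import structures.
From mathcomp Require Import all_boot all_order all_algebra.
From mathcomp Require Import all_classical all_reals all_analysis.

Set Implicit Arguments.
Unset Strict Implicit.
Unset Printing Implicit Defensive.

Import Order.TTheory GRing.Theory Num.Theory.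
Import numFieldNormedType.Exports.

Local Open Scope classical_set_scope.
Local Open Scope ring_scope.

Section euclidean_calculus.
Context {R : realType} {n : nat}.
Implicit Types (x y : 'rV[R]_n) (u : 'rV[R]_n -> R).

Definition partial (i : 'I_n) u : 'rV[R]_n -> R := 'D_(delta_mx 0 i) u.

(* ['D_v u x] is a total operator with a default value where the limit of the
   difference quotients does not exist, so existence of the partial derivatives
   has to be required separately from their continuity. *)
Definition C2 u : Prop :=
  [/\ continuous u,
      forall i : 'I_n, (forall x, derivable u x (delta_mx 0 i)) /\
                       continuous (partial i u)
    & forall i j : 'I_n,
        (forall x, derivable (partial i u) x (delta_mx 0 j)) /\
        continuous (partial j (partial i u))].

Definition grad u x : 'rV[R]_n := \row_i partial i u x.

Definition laplacian u x : R := \sum_(i < n) partial i (partial i u) x.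

Definition dotv x y : R := \sum_(i < n) x 0 i * y 0 i.

(* The library norm [`|x|] on ['rV[R]_n] is the sup norm. *)
Definition enorm x : R := Num.sqrt (dotv x x).

End euclidean_calculus.

Definition p_star (R : realType) (n : nat) : \bar R :=
  if (n <= 2)%N then +oo%E else ((n%:R + 2) / (n%:R - 2))%:E.

Definition classical_solution (R : realType) (n : nat) (p beta : R)
    (u : 'rV[R]_n -> R) : Prop :=
  C2 u /\
  forall x, laplacian u x - 2^-1 * dotv x (grad u x)
            + `|u x| `^ (p - 1) * u x - beta * u x = 0.

(* Main.v *)
Require Import Defs.
From HB Require Import structures.
From mathcomp Require Import all_boot all_order all_algebra.
From mathcomp Require Import all_classical all_reals all_analysis.
From mathcomp Require Import ring lra.

Import Order.TTheory GRing.Theory Num.Theory.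
Import numFieldNormedType.Exports.

Local Open Scope classical_set_scope.
Local Open Scope ring_scope.

(** Write G = |grad u|^2, v = 1 + u and N = u^p - beta u, so that the equation reads
Delta u - x.grad u / 2 = - N.  The proof has two halves: u and its
gradient grow at most polynomially, and a solution with that growth has
zero gradient.

Growth.  This is a Bernstein argument.  For the critical equation
Delta u + u^p = 0, n >= 3, the quantity u^(-a) G + c u^b, with a + b = p + 1, is
constant on the radial bubbles for suitable a and c; for p < p_* there is room to
choose a, c and an auxiliary parameter l such that it is a strict subsolution
wherever it is large ([exist_good_exponents]).  Fix r and maximise s^2 (v^(-a) G + c v^b),
s = r^2 - |x|^2, over the ball of radius r.  At the maximum the function G is
touched from above by the barrier K v^a / s^2 - c v^(p+1): the gradients agree
and the Laplacians are ordered ([bernstein_max]).  Bochner's formula expresses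
the Laplacian of G through |D^2 u|^2, which is bounded below by testing the
Hessian against a combination of grad u (x) grad u and the identity
([hessian_lower]).  What results ([barrier_touching_inequality]) is an inequality
between X = G / v^2 and Y = v^(p-1) whose leading part is a quadratic
form with positive coefficients.  The remaining terms, which come from the drift,
the cutoff and the shift from u to v, are of lower order and cost only powers of r
([bernstein_algebra]), whence [bernstein_estimate] and [solution_polygrowth].
Working with v >= 1 rather than u keeps all powers regular at zeros of u and
makes the weight v^(2-a) bounded, so that the value at the maximum controls the
values elsewhere without a Harnack inequality.

Since u is only of class C^2, G has no second derivatives in general.  It is
replaced by the sum of squared difference quotients of u, whose Laplacian
converges locally uniformly to the right-hand side of Bochner's formula because
Delta u is of class C^1 by the equation.

Rigidity.  The Pohozaev identity of Giga and Kohn is the integral of a pointwise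
identity: with rho = exp(-|x|^2/4) there is a vector field V, polynomial in x, u,
grad u and u^(p+1), with div(rho V) = rho G (A + B |x|^2), and A, B > 0 because
1 < p < p_* ([pohozaev_identity]).  By the first half rho V decays faster than
every power of |x|, and a field that decays like |x|^(-n) and whose divergence is
nonnegative is divergence free ([divergence_ge0_eq0]).  Hence G = 0. *)

Set Implicit Arguments.
Unset Strict Implicit.
Unset Printing Implicit Defensive.

Local Notation "''e_' i" := (delta_mx 0 i)
  (at level 8, i at level 2, format "''e_' i") : ring_scope.

(** * Calculus along lines *)

Section LineCalculus.
Context {R : realType} {n : nat}.
Local Notation V := 'rV[R]_n.
Implicit Types (f g : V -> R) (x y v w : V) (t h : R).

Lemma is_derive_line f x v t d :
  is_derive (t *: v + x) v f d -> is_derive t 1 (fun h : R => f (h *: v + x)) d.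
Proof.
have E : (fun h : R => h^-1 *: (((fun s => f (s *: v + x)) \o shift t) (h *: 1)
            - f (t *: v + x)))
       = (fun h : R => h^-1 *: ((f \o shift (t *: v + x)) (h *: v)
            - f (t *: v + x))).
  apply/funext => h /=; rewrite scalerDl -addrA.
  by rewrite (_ : h *: (1 : R) = h) // [_ *: _]mulr1.
by case=> df <-; apply: DeriveDef; rewrite /derivable /derive E.
Qed.

Lemma line_is_derive f x v d :
  is_derive (0:R) 1 (fun h : R => f (h *: v + x)) d -> is_derive x v f d.
Proof.
have E : (fun h : R => h^-1 *: (((fun s => f (s *: v + x)) \o shift 0) (h *: 1)
            - f (0 *: v + x)))
       = (fun h : R => h^-1 *: ((f \o shift x) (h *: v) - f x)).
  apply/funext => h /=; rewrite addr0 scale0r add0r.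
  by rewrite (_ : h *: (1 : R) = h) // [_ *: _]mulr1.
by case; rewrite /derivable /derive E => df <-; apply: DeriveDef.
Qed.

(** The derivative of [f] is only assumed along one line, so this is the chain
    rule in one variable, transported to that line. *)
Lemma is_derive_comp (g : R -> R) f x v df dg :
  is_derive (f x) 1 g dg -> is_derive x v f df ->
  is_derive x v (fun y => g (f y)) (dg * df).
Proof.
move=> hg hf; apply: line_is_derive.
apply: (@is_derive1_comp _ g (fun h : R => f (h *: v + x))).
  by rewrite scale0r add0r.
by apply: is_derive_line; rewrite scale0r add0r.
Qed.

Lemma is_derive_bigsum (I : finType) (h : I -> V -> R) x v (dh : I -> R) :
  (forall i, is_derive x v (h i) (dh i)) ->
  is_derive x v (fun y => \sum_i h i y) (\sum_i dh i).
Proof.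
move=> H; have -> : (fun y => \sum_i h i y) = \sum_i h i.
  by apply/funext => y; rewrite fct_sumE.
elim/big_ind2 : _ => [|f1 d1 f2 d2 H1 H2|i _]; [exact: is_derive_cst| |exact: H].
exact: is_deriveD.
Qed.

Lemma is_derive_coord x v j : is_derive x v (fun y : V => y 0 j) (v 0 j).
Proof.
apply: line_is_derive.
have -> : (fun h : R => (h *: v + x) 0 j) = (id * cst (v 0 j) + cst (x 0 j)).
  by apply/funext => h; rewrite !mxE.
apply: is_derive_eq.
by rewrite /= scaler0 add0r addr0 [LHS]mulr1.
Qed.

(** The intermediate point is located by a parameter no larger than [h] in
    absolute value, for both signs of [h]: this is what makes the estimate
    uniform in the base point. *)
Lemma directional_mvt f (f1 : V -> R) x v h : 
  (forall y, is_derive y v f (f1 y)) ->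
  exists2 t, `|t| <= `|h| & f (h *: v + x) - f x = h * f1 (t *: v + x).
Proof.
move=> df.
pose g (s : R) := f (s *: v + x).
have dg (s : R) : is_derive s (1 : R) g (f1 (s *: v + x)) by apply: is_derive_line.
have cg (A : set R) : {within A, continuous g}.
  apply: continuous_subspaceT => s.
  apply/differentiable_continuous; rewrite -derivable1_diffP.
  by have [] := dg s.
have g0 : g 0 = f x by rewrite /g scale0r add0r.
have [h0|h0] := leP 0 h.
  have [c] := MVT_segment h0 (fun s _ => dg s) (cg _).
  rewrite in_itv /= => /andP[c0 ch]; rewrite g0 subr0 mulrC => E.
  by exists c => //; rewrite !ger0_norm.
have [c] := MVT_segment (ltW h0) (fun s _ => dg s) (cg _).
rewrite in_itv /= => /andP[hc c0]; rewrite g0 sub0r => E.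
exists c; first by rewrite !ler0_norm ?lerN2 // ltW.
by rewrite -[LHS]opprB E mulrN opprK mulrC.
Qed.

(** Convergence is joint in the base point and the increment, which is locally
    uniform convergence of difference quotients. It follows from the mean value
    theorem and the continuity of the derivative at [x] alone. *)
Lemma cvg_difference_quotient f (f1 : V -> R) x v :
  (forall y, is_derive y v f (f1 y)) -> {for x, continuous f1} ->
  (fun p : V * R => p.2^-1 * (f (p.2 *: v + p.1) - f p.1))
    @ filter_prod (nbhs x) 0^' --> f1 x.
Proof.
move=> df cf.
apply/cvgrPdist_le => e e0.
have /cvgrPdist_le/(_ e e0) := cf.
move=> /nbhs_ballP[r /= r0 Hr].
have [d d0 Hd] : exists2 d : R, 0 < d & d * `|v| < r / 2.
  exists (r / 2 / (`|v| + 1)).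
    by rewrite !divr_gt0 // ltr_wpDl.
  rewrite mulrAC ltr_pdivrMr ?ltr_wpDl // ltr_pM2l ?divr_gt0 //.
  by rewrite ltrDl.
exists (ball x (r / 2), [set h | 0 < `|h| < d]) => /=.
  split; first by apply: nbhsx_ballx; rewrite divr_gt0.
  exists d => // h /=; rewrite sub0r normrN => -> h0.
  by rewrite normr_gt0 h0.
move=> [y h] /= [xy /andP[h0 hd]].
have [t th ->] := directional_mvt y h df.
rewrite mulKf ?normr_gt0 -?normr_gt0//; apply: Hr.
move: xy; rewrite -!ball_normE /= => xy.
rewrite opprD addrA addrAC; apply: le_lt_trans (ler_normB _ _) _.
rewrite [ltRHS]splitr ltrD // normrZ; apply: le_lt_trans Hd.
by rewrite ler_wpM2r // (le_trans th) // ltW.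
Qed.
End LineCalculus.

(** * Tests at a local maximum and symmetry of second derivatives *)

Section MaxTests.
Context {R : realType} {n : nat}.
Local Notation V := 'rV[R]_n.
Implicit Types (f g : V -> R) (x y v w : V) (t h : R).

Lemma near_line (P : V -> Prop) x v :
  (\forall y \near x, P y) ->
  exists2 r : R, 0 < r & forall t, `|t| < r -> P (t *: v + x).
Proof.
move=> /nbhs_ballP[r /= r0 Hr].
have v1 : 0 < `|v| + 1 by rewrite ltr_wpDl.
exists (r / (`|v| + 1)); first by rewrite divr_gt0.
move=> t; rewrite ltr_pdivlMr // => tr; apply: Hr.
rewrite -ball_normE /= opprD addrCA subrr addr0 normrN normrZ.
by apply: le_lt_trans tr; rewrite ler_wpM2l // lerDl.
Qed.

Lemma local_max_derive_eq0 f (f1 : V -> R) x v :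
  (\forall y \near x, is_derive y v f (f1 y)) ->
  (\forall y \near x, f y <= f x) -> f1 x = 0.
Proof.
move=> /(near_line v)[r r0 Hr] /(near_line v)[r' r'0 Hr'].
pose s := Num.min r r'.
have s0 : 0 < s by rewrite lt_min r0.
have Hs t : t \in `](-s), s[ -> `|t| < r /\ `|t| < r'.
  rewrite in_itv /= -ltr_norml => ts; split; apply: (lt_le_trans ts).
    by rewrite ge_min lexx.
  by rewrite ge_min lexx orbT.
have dg t : `|t| < r ->
    is_derive t (1 : R) (fun h : R => f (h *: v + x)) (f1 (t *: v + x)).
  by move=> tr; apply: is_derive_line; apply: Hr.
have : is_derive (0 : R) (1 : R) (fun h : R => f (h *: v + x)) 0.
  apply: (@derive1_at_max _ _ (-s) s).
  - by rewrite ge0_cp // ltW.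
  - by move=> t /Hs[tr _]; have [] := dg _ tr.
  - by rewrite in_itv /= oppr_lt0 s0.
  - by move=> t /Hs[_ tr]; rewrite scale0r add0r; apply: Hr'.
case=> _ <-.
have [|_ ->] := dg 0; first by rewrite normr0.
by rewrite scale0r add0r.
Qed.

(** If the second derivative were positive, the first derivative, which vanishes
    at [x], would be positive just after [x] and the mean value theorem would
    contradict maximality. *)
Lemma local_max_derive2_le0 f (f1 : V -> R) x v d2 :
  (\forall y \near x, is_derive y v f (f1 y)) ->
  is_derive x v f1 d2 ->
  (\forall y \near x, f y <= f x) -> d2 <= 0.
Proof.
move=> df df1 mx.
have f10 : f1 x = 0 by apply: local_max_derive_eq0 df mx.
move: df mx => /(near_line v)[r r0 Hr] /(near_line v)[r' r'0 Hr'].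
rewrite leNgt; apply/negP => d20.
have [q q0 Hq] : exists2 q : R, 0 < q &
    forall t, 0 < t < q -> 0 < f1 (t *: v + x).
  case: df1 => + d2E; rewrite /derivable => /cvgP cv.
  have : (fun h : R => h^-1 *: ((f1 \o shift x) (h *: v) - f1 x)) @ 0^' --> d2.
    by rewrite -d2E; move: cv => /cvg_ex[l ll]; rewrite /derive (cvg_lim _ ll).
  move=> /cvgrPdist_lt/(_ _ d20)[q /= q0 Hq]; exists q => // t /andP[t0 tq].
  have := Hq t; rewrite /= sub0r normrN gtr0_norm // => /(_ tq (lt0r_neq0 t0)).
  rewrite f10 subr0 => H.
  have : 0 < t^-1 * f1 (t *: v + x).
    by move: H; rewrite ltr_distlC => /andP[+ _]; rewrite subrr.
  by rewrite pmulr_rgt0 // invr_gt0.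
pose s := Num.min (Num.min r r') q / 2.
have m0 : 0 < Num.min (Num.min r r') q by rewrite !lt_min r0 r'0 q0.
have s0 : 0 < s by rewrite divr_gt0.
have sm : s < Num.min (Num.min r r') q by rewrite ltr_pdivrMr // ltr_pMr // ltr1n.
move: sm; rewrite !lt_min => /andP[/andP[sr sr'] sq].
have dg t : `|t| < r ->
    is_derive t (1 : R) (fun h : R => f (h *: v + x)) (f1 (t *: v + x)).
  by move=> tr; apply: is_derive_line; apply: Hr.
have abs t : t \in `[0, s] -> `|t| < r.
  rewrite in_itv /= => /andP[t0 ts]; rewrite ger0_norm //.
  exact: le_lt_trans sr.
have [|t] := MVT s0 (fun t ht => dg t (abs t (subset_itv_oo_cc ht))).
  apply: derivable_within_continuous => t /abs tr.
  by have [] := dg _ tr.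
rewrite in_itv /= => /andP[t0 ts]; rewrite scale0r add0r subr0 => E.
have := Hr' s; rewrite gtr0_norm // => /(_ sr'); apply/negP; rewrite -ltNge.
by rewrite -subr_gt0 E mulr_gt0 // Hq // t0 (lt_trans ts).
Qed.

(** Schwarz's theorem. The second-order difference of [f] over the parallelogram
    spanned by [h v] and [h w] equals, by two applications of the mean value
    theorem, [h^2] times either mixed derivative at a point close to [x]. *)
Lemma derive_comm f (f1 : V -> V -> R) (f2 : V -> V -> V -> R) v w x :
  (forall y, is_derive y v f (f1 v y)) ->
  (forall y, is_derive y w f (f1 w y)) ->
  (forall y, is_derive y w (f1 v) (f2 v w y)) ->
  (forall y, is_derive y v (f1 w) (f2 w v y)) ->
  {for x, continuous (f2 v w)} -> {for x, continuous (f2 w v)} ->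
  f2 v w x = f2 w v x.
Proof.
wlog le : v w / f2 v w x <= f2 w v x.
  move=> H dv dw dvw dwv cvw cwv.
  have [le|/ltW le] := leP (f2 v w x) (f2 w v x); first exact: H.
  by apply/esym/H.
move=> dv dw dvw dwv cvw cwv.
apply/eqP; rewrite eq_le le /= leNgt; apply/negP => lt.
pose e := (f2 w v x - f2 v w x) / 2.
have e0 : 0 < e by rewrite divr_gt0 // subr_gt0.
have key a b : (forall y, is_derive y a f (f1 a y)) ->
    (forall y, is_derive y b (f1 a) (f2 a b y)) ->
    {for x, continuous (f2 a b)} ->
  exists2 r : R, 0 < r & forall h, 0 < h < r ->
    `|f (h *: a + (h *: b + x)) - f (h *: b + x) - (f (h *: a + x) - f x)
      - h * h * f2 a b x| < h * h * e.
  move=> da dab cab.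
  move/cvgrPdist_lt: cab => /(_ e e0) /nbhs_ballP[r /= r0 Hr].
  pose M := `|a| + `|b| + 1.
  have M0 : 0 < M by rewrite ltr_wpDl // addr_ge0.
  exists (r / M); first by rewrite divr_gt0.
  move=> h /andP[h0]; rewrite ltr_pdivlMr // => hr.
  have dphi y : is_derive y a (fun y => f (h *: b + y) - f y)
      (f1 a (h *: b + y) - f1 a y).
    apply: (@is_deriveB _ _ _ (fun y => f (h *: b + y)) f).
    apply: line_is_derive.
    have -> : (fun s : R => f (h *: b + (s *: a + y)))
            = (fun s : R => f (s *: a + (h *: b + y))).
      by apply/funext => s; rewrite addrCA.
    by apply: is_derive_line; rewrite scale0r add0r; apply: da.
  have [t th E1] := directional_mvt x h dphi.
  have [s sh E2] := directional_mvt (t *: a + x) h dab.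
  have -> : f (h *: a + (h *: b + x)) - f (h *: b + x) - (f (h *: a + x) - f x)
     = h * h * f2 a b (s *: b + (t *: a + x)).
    rewrite -mulrA -E2 -E1 /= [h *: a + _]addrCA; ring.
  rewrite -mulrBr normrM (gtr0_norm (mulr_gt0 h0 h0)) ltr_pM2l ?mulr_gt0 //.
  rewrite distrC; apply: Hr.
  rewrite -ball_normE /= addrA opprD addrCA subrr addr0 normrN.
  apply: le_lt_trans hr; apply: le_trans (ler_normD _ _) _.
  rewrite (gtr0_norm h0) in th sh.
  rewrite !normrZ /M !mulrDr mulr1.
  have Ha : `|t| * `|a| <= h * `|a| by rewrite ler_wpM2r.
  have Hb : `|s| * `|b| <= h * `|b| by rewrite ler_wpM2r.
  lra.
have [r r0 Hr] := key v w dv dvw cvw.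
have [r' r'0 Hr'] := key w v dw dwv cwv.
pose h := Num.min r r' / 2.
have m0 : 0 < Num.min r r' by rewrite !lt_min r0 r'0.
have h0 : 0 < h by rewrite divr_gt0.
have : h < Num.min r r' by rewrite ltr_pdivrMr // ltr_pMr // ltr1n.
rewrite !lt_min => /andP[hr hr'].
have := Hr' h; rewrite h0 hr' => /(_ isT).
have := Hr h; rewrite h0 hr => /(_ isT).
rewrite [h *: w + (_ + _)]addrCA.
set A := f (_ + (_ + _)); set B := f _; set C := f _; set D := f x.
rewrite !ltr_distl => /andP[_ H1] /andP[H2 _].
have : h * h * f2 w v x - h * h * e < h * h * f2 v w x + h * h * e.
  apply: lt_trans H1; rewrite (_ : A - B - _ = A - C - (B - D)) //; ring.
rewrite -mulrBr -mulrDr ltr_pM2l ?mulr_gt0 // /e; lra.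
Qed.
End MaxTests.

(** * Bernstein's method for functions of class C2 *)

Section Bernstein.
Context {R : realType} {n : nat}.
Local Notation V := 'rV[R]_n.
Implicit Types (f g : V -> R) (x y v w : V) (t h : R).

Lemma cvg_fin_sum (I : finType) (T : Type) (F : set_system T) {FF : Filter F}
    (f : I -> T -> R) (a : I -> R) :
  (forall i, f i x @[x --> F] --> a i) ->
  (\sum_i f i x) @[x --> F] --> \sum_i a i.
Proof. by move=> H; apply: cvg_big => //; exact: add_continuous. Qed.

Lemma cvg_sqr (T : Type) (F : set_system T) {FF : Filter F} (f : T -> R) (a : R) :
  f x @[x --> F] --> a -> (f x ^+ 2) @[x --> F] --> a ^+ 2.
Proof.
move=> H; rewrite expr2.
by under eq_fun do rewrite expr2; exact: cvgM.
Qed.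

Lemma is_derive_sqr f x v d :
  is_derive x v f d -> is_derive x v (fun y => f y ^+ 2) (2 * f x * d).
Proof.
move=> df; have -> : (fun y => f y ^+ 2) = f ^+ 2 by apply/funext.
by apply: is_derive_eq; rewrite /= expr1.
Qed.

Lemma is_derive_difference_quotient f (f1 : V -> R) w h x v :
  (forall y, is_derive y v f (f1 y)) ->
  is_derive x v (fun y => h^-1 * (f (h *: w + y) - f y))
                (h^-1 * (f1 (h *: w + x) - f1 x)).
Proof.
move=> df.
apply: (@is_deriveZ _ _ _ (fun y => f (h *: w + y) - f y)).
apply: (@is_deriveB _ _ _ (fun y => f (h *: w + y)) f).
apply: line_is_derive.
have -> : (fun s : R => f (h *: w + (s *: v + x)))
        = (fun s : R => f (s *: v + (h *: w + x))).
  by apply/funext => s; rewrite addrCA.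
by apply: is_derive_line; rewrite scale0r add0r.
Qed.

Lemma is_derive_coordB x v k (a : R) :
  is_derive x v (fun y : V => y 0 k - a) (v 0 k).
Proof.
rewrite -[X in is_derive _ _ _ X]subr0.
apply: (@is_deriveB _ _ _ (fun y : V => y 0 k) (cst a)).
exact: is_derive_coord.
Qed.

Lemma coord_le_norm x j : `|x 0 j| <= `|x|.
Proof.
rewrite [leRHS]/Num.norm /= mx_normrE.
by apply/bigmax_geP; right => /=; exists (0, j).
Qed.

(** The norm on row vectors is the sup norm, so this is a box. *)
Lemma closed_box_compact x r : compact [set y : V | `|y - x| <= r].
Proof.
apply: bounded_closed_compact.
  exists (`|x| + r); split; first exact: num_real.
  move=> M HM y /= yx; apply/ltW; apply: le_lt_trans HM.
  rewrite -[y](subrK x) addrC; apply: le_trans (ler_normD _ _) _.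
  by rewrite lerD2l.
have -> : [set y : V | `|y - x| <= r] = (fun y => `|y - x|) @^-1` [set t | t <= r].
  by [].
apply: closed_comp => [y _|]; last exact: closed_le.
apply: (@continuous_comp _ _ _ (fun y => y - x) (@Num.norm _ V)); last exact: norm_continuous.
by apply: continuousB; [exact: cvg_id|exact: cst_continuous].
Qed.

(** Bernstein's method without third derivatives. If [|grad u|^2 <= B] near [x]
    with equality at [x], then, formally, the maximum principle gives the
    equality of the gradients and the inequality between Laplacians, the
    Laplacian of [|grad u|^2] being replaced by the right-hand side of Bochner's
    formula. The first claim is the first-order condition. For the second,
    suppose that it fails; replace [|grad u|^2] by the sum of the squares of the
    difference quotients of step [h], which is of class C^2, and penalise by a
    small multiple of the squared distance to [x]. For small [h] the maximum on
    a small box is then attained in the interior, where the Laplacian is at the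
    same time nonpositive and close to a positive number. *)
Lemma bernstein_max (u : V -> R) (u1 : 'I_n -> V -> R)
    (u2 : 'I_n -> 'I_n -> V -> R) (w1 : 'I_n -> V -> R)
    (B : V -> R) (b1 b2 : 'I_n -> V -> R) x :
  continuous u ->
  (forall i y, is_derive y 'e_i u (u1 i y)) ->
  (forall i, continuous (u1 i)) ->
  (forall i j y, is_derive y 'e_j (u1 i) (u2 i j y)) ->
  (forall i j, continuous (u2 i j)) ->
  (forall i y, is_derive y 'e_i (fun z => \sum_j u2 j j z) (w1 i y)) ->
  (forall i, continuous (w1 i)) ->
  (\forall y \near x, {for y, continuous B}) ->
  (forall j, \forall y \near x, is_derive y 'e_j B (b1 j y)) ->
  (forall j, \forall y \near x, is_derive y 'e_j (b1 j) (b2 j y)) ->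
  (forall j, {for x, continuous (b2 j)}) ->
  (\forall y \near x, \sum_i u1 i y ^+ 2 <= B y) ->
  \sum_i u1 i x ^+ 2 = B x ->
  (forall j, 2 * \sum_i u1 i x * u2 i j x = b1 j x) /\
  2 * (\sum_j \sum_i u2 i j x ^+ 2) + 2 * (\sum_i u1 i x * w1 i x)
    <= \sum_j b2 j x.
Proof.
move=> cu du cu1 du1 cu2 dw cw cB dB db cb GB GBx.
split.
  move=> j; pose F1 y := (\sum_i 2 * u1 i y * u2 i j y) - b1 j y.
  have : F1 x = 0.
    apply: (@local_max_derive_eq0 _ _ (fun y => (\sum_i u1 i y ^+ 2) - B y) F1 x 'e_j).
      near=> y.
      apply: (@is_deriveB _ _ _ (fun y => (\sum_i u1 i y ^+ 2)) B).
        by apply: is_derive_bigsum => i; apply: is_derive_sqr.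
      by near: y; apply: dB.
    near=> y; rewrite GBx subrr subr_le0.
    by near: y.
  rewrite /F1 => /eqP; rewrite subr_eq0 => /eqP <-.
  by rewrite mulr_sumr; apply: eq_bigr => i _; rewrite mulrA.
rewrite leNgt; apply/negP => gap.
pose q i (y : V) (h : R) := h^-1 * (u (h *: 'e_i + y) - u y).
pose qj i j (y : V) (h : R) := h^-1 * (u1 j (h *: 'e_i + y) - u1 j y).
pose qjj i j (y : V) (h : R) := h^-1 * (u2 j j (h *: 'e_i + y) - u2 j j y).
pose w y := \sum_j u2 j j y.
pose qw i (y : V) (h : R) := h^-1 * (w (h *: 'e_i + y) - w y).
pose Lap y h := 2 * (\sum_j \sum_i qj i j y h ^+ 2) + 2 * (\sum_i q i y h * qw i y h)
   - \sum_j b2 j y.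
pose gapv := 2 * (\sum_j \sum_i u2 i j x ^+ 2) + 2 * (\sum_i u1 i x * w1 i x)
    - \sum_j b2 j x.
have gap0 : 0 < gapv by rewrite subr_gt0.
(* The penalty [dl * D] has Laplacian [2 * n * dl], at most half of the gap. *)
pose dl := gapv / (4 * (n%:R + 1)).
have n1 : 0 < n%:R + 1 :> R by rewrite ltr_wpDl.
have dl0 : 0 < dl by rewrite divr_gt0 // mulr_gt0.

have fstC g y : {for y, continuous g} ->
    (fun p : V * R => g p.1) @ filter_prod (nbhs y) 0^' --> g y.
  by move=> cg; apply: (cvg_comp _ _ (cvg_fst (G := (0:R)^'))); exact: cg.
have LapC : (fun p : V * R => Lap p.1 p.2) @ filter_prod (nbhs x) 0^' --> gapv.
  apply: cvgB; last first.
    apply: cvg_fin_sum => j; apply: fstC; exact: cb.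
  apply: cvgD; apply: cvgMl_tmp.
    rewrite exchange_big; apply: cvg_fin_sum => i; apply: cvg_fin_sum => j.
    apply: cvg_sqr.
    by apply: cvg_difference_quotient => //; apply: cu2.
  apply: cvg_fin_sum => i; apply: cvgM.
    by apply: cvg_difference_quotient => //; apply: cu1.
  by apply: cvg_difference_quotient => //; apply: cw.
have HC y : (fun p : V * R => \sum_i q i p.1 p.2 ^+ 2 - \sum_i u1 i p.1 ^+ 2)
     @ filter_prod (nbhs y) 0^' --> (0 : R).
  suff : (fun p : V * R => \sum_i q i p.1 p.2 ^+ 2 - \sum_i u1 i p.1 ^+ 2)
     @ filter_prod (nbhs y) 0^' --> \sum_i u1 i y ^+ 2 - \sum_i u1 i y ^+ 2.
    by rewrite subrr.
  apply: cvgB; apply: cvg_fin_sum => i;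
    apply: cvg_sqr.
    by apply: cvg_difference_quotient => //; apply: cu1.
  apply: fstC; exact: cu1.
have : \forall p \near filter_prod (nbhs x) (0 : R)^', gapv / 2 < Lap p.1 p.2.
  by move/cvgr_gt : LapC; apply; rewrite ltr_pdivrMr // ltr_pMr // ltr1n.
case=> -[U W] /= [Ux W0] UW.
have dBn : \forall y \near x, forall j, is_derive y 'e_j B (b1 j y).
  exact: (@filter_forall V _ (fun j => [set y | is_derive y 'e_j B (b1 j y)]) (nbhs x) _ dB).
have dbn : \forall y \near x, forall j, is_derive y 'e_j (b1 j) (b2 j y).
  exact: (@filter_forall V _ (fun j => [set y | is_derive y 'e_j (b1 j) (b2 j y)]) (nbhs x) _ db).
have : \forall y \near x, [/\ U y, {for y, continuous B},
     forall j, is_derive y 'e_j B (b1 j y), forall j, is_derive y 'e_j (b1 j) (b2 j y)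
     & \sum_i u1 i y ^+ 2 <= B y].
  by near=> y; split; near: y.
move=> /nbhs_ballP[r0 /= r00 Hr0].
pose r := r0 / 2.
have rr0 : 0 < r by rewrite divr_gt0.
have Kball y : `|y - x| <= r -> ball x r0 y.
  move=> yr; rewrite -ball_normE /= distrC (le_lt_trans yr) //.
  by rewrite ltr_pdivrMr // ltr_pMr // ltr1n.
pose K := [set y : V | `|y - x| <= r].
pose eps := dl * r ^+ 2 / 3.
have eps0 : 0 < eps by rewrite divr_gt0 // mulr_gt0 // exprn_gt0.
(* On the boundary of the box the penalty is at least [3 * eps], which beats the error made
   in replacing [u1] by difference quotients, both there and at [x]. *)
have unif : \forall h \near (0 : R)^', K `<=` (fun y =>
     `|\sum_i q i y h ^+ 2 - \sum_i u1 i y ^+ 2| < eps).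
  have /compact_near_coveringP := @closed_box_compact x r.
  apply => y Ky.
  have /cvgr0_norm_lt/(_ _ eps0)[[U' W'] /= [U'y W'0] UW'] := HC y.
  by exists (U', W') => // -[y' h] /= [yU hW]; exact: (UW' (y', h)).
have [h [hW hK hneq]] : exists h : R, [/\ W h, K `<=` (fun y =>
     `|\sum_i q i y h ^+ 2 - \sum_i u1 i y ^+ 2| < eps) & h != 0].
  have : \forall h \near (0 : R)^', [/\ W h, K `<=` (fun y =>
     `|\sum_i q i y h ^+ 2 - \sum_i u1 i y ^+ 2| < eps) & h != 0].
    near=> h; split; near: h => //; exact: nbhs_dnbhs_neq.
  exact: filter_ex.
pose D (y : V) := \sum_k (y 0 k - x 0 k) ^+ 2.
pose Phi y := \sum_i q i y h ^+ 2 - B y - dl * D y.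
have Kx : K x by rewrite /K /= subrr normr0 ltW.
have cq i : continuous (fun y => q i y h).
  move=> y; rewrite /q; apply: (@cvgMl_tmp _ _ (nbhs y)).
  apply: (@cvgB _ _ _ (nbhs y)); last exact: cu.
  apply: (@continuous_comp _ _ _ (fun y : V => h *: 'e_i + y) u); last exact: cu.
  by apply: (@cvgD _ _ _ (nbhs y)); [exact: cvg_cst|exact: cvg_id].
have cPhi : {within K, continuous Phi}.
  apply: continuous_in_subspaceT => y; rewrite inE => Ky.
  apply: (@cvgB _ _ _ (nbhs y)); first apply: (@cvgB _ _ _ (nbhs y)).
  - apply: cvg_fin_sum => i.
    by apply: cvg_sqr; apply: cq.
  - by have [] := Hr0 _ (Kball _ Ky).
  apply: (@cvgMl_tmp _ _ (nbhs y)); apply: cvg_fin_sum => k.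
  apply: cvg_sqr.
  by apply: cvgB; [exact: coord_continuous|exact: cvg_cst].
have [z zK Hz] := compact_EVT_max (ex_intro _ x Kx) (@closed_box_compact x r) cPhi.
rewrite inE in zK.
have Phix : - eps < Phi x.
  rewrite /Phi /D [X in _ * X]big1 ?mulr0 ?subr0; last first.
    by move=> k _; rewrite subrr expr0n.
  by have := hK _ Kx; rewrite GBx ltr_norml => /andP[].
have zr : `|z - x| < r.
  rewrite lt_neqAle zK andbT; apply/eqP => zr.
  have Dz : r ^+ 2 <= D z.
    have : mx_norm (z - x) != 0 by rewrite -[mx_norm _]/`|z - x| zr gt_eqF.
    move=> /mx_norm_neq0[[i k]] /= E.
    rewrite -zr [`|z - x|]E (ord1 i) !mxE real_normK ?num_real //.
    by rewrite /D (bigD1 k) //= lerDl sumr_ge0 // => l _; rewrite sqr_ge0.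
  have := Hz x (mem_set Kx); apply/negP; rewrite -ltNge.
  apply: le_lt_trans Phix.
  have := hK _ zK; have [_ _ _ _ GBz] := Hr0 _ (Kball _ zK).
  rewrite /Phi ltr_norml => /andP[_].
  have : dl * r ^+ 2 <= dl * D z by rewrite ler_pM2l.
  have : dl * r ^+ 2 = 3 * eps by rewrite /eps; field.
  by move=> *; lra.
have nearz : \forall y \near z, `|y - x| < r.
  apply/nbhs_ballP; exists (r - `|z - x|); first by rewrite /= subr_gt0.
  move=> y; rewrite -ball_normE /= => yz.
  rewrite -[y](subrK z) -addrA; apply: le_lt_trans (ler_normD _ _) _.
  by rewrite distrC; lra.
pose F1 j y := (\sum_i 2 * q i y h * qj i j y h) - b1 j y - dl * (2 * (y 0 j - x 0 j)).
have Lz j : \sum_i (2 * (qj i j z h ^+ 2) + 2 * (q i z h * qjj i j z h))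
     - b2 j z - dl * 2 <= 0.
  apply: (@local_max_derive2_le0 _ _ Phi (F1 j) z 'e_j).
  - near=> y.
    have yr : `|y - x| <= r by apply: ltW; near: y.
    apply: (@is_deriveB _ _ _ (fun y => \sum_i q i y h ^+ 2 - B y) (fun y => dl * D y)).
      apply: (@is_deriveB _ _ _ (fun y => \sum_i q i y h ^+ 2) B).
        apply: is_derive_bigsum => i; apply: is_derive_sqr.
        by apply: is_derive_difference_quotient.
      by have [] := Hr0 _ (Kball _ yr).
    apply: (@is_deriveZ _ _ _ D).
    have -> : 2 * (y 0 j - x 0 j) = \sum_k 2 * (y 0 k - x 0 k) * ('e_j : V) 0 k.
      rewrite (bigD1 j) //= big1 ?addr0 => [|k kj].
        by rewrite mxE !eqxx mulr1.
      by rewrite mxE (negbTE kj) andbF mulr0.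
    apply: is_derive_bigsum => k; apply: is_derive_sqr.
    exact: is_derive_coordB.
  - apply: (@is_deriveB _ _ _ (fun y => \sum_i 2 * q i y h * qj i j y h - b1 j y)
        (fun y => dl * (2 * (y 0 j - x 0 j)))).
      apply: (@is_deriveB _ _ _ (fun y => \sum_i 2 * q i y h * qj i j y h) (b1 j)).
        apply: is_derive_bigsum => i.
        have -> : (fun y => 2 * q i y h * qj i j y h)
           = 2 \*: ((fun y => q i y h) * (fun y => qj i j y h)).
          by apply/funext => y /=; rewrite -mulrA.
        apply: is_derive_eq.
          apply: is_deriveZ; apply: is_deriveM; exact: is_derive_difference_quotient.
        by rewrite /qj /qjj /q /= -!/(_ * _) /GRing.scale /=; ring.
      by have [] := Hr0 _ (Kball _ zK).
    apply: (@is_deriveZ _ _ _ (fun y : V => 2 * (y 0 j - x 0 j))).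
    rewrite -[X in is_derive _ _ _ X]mulr1.
    apply: (@is_deriveZ _ _ _ (fun y : V => (y 0 j - x 0 j))).
    by have := is_derive_coordB z 'e_j j (x 0 j); rewrite mxE !eqxx.
  - near=> y; apply: Hz; rewrite inE; apply: ltW; near: y; exact: nearz.
have : \sum_j (\sum_i (2 * (qj i j z h ^+ 2) + 2 * (q i z h * qjj i j z h))
     - b2 j z - dl * 2) <= 0 by apply: sumr_le0 => j _; exact: Lz.
rewrite !big_split /= !sumrN sumr_const card_ord.
under eq_bigr do rewrite big_split /= -!mulr_sumr.
rewrite big_split /= -!mulr_sumr [X in _ + 2 * X]exchange_big /=.
have -> : \sum_i \sum_j q i z h * qjj i j z h = \sum_i q i z h * qw i z h.
  apply: eq_bigr => i _; rewrite -mulr_sumr; congr (_ * _).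
  by rewrite /qw /w -sumrB mulr_sumr.
have [Uz _ _ _ _] := Hr0 _ (Kball _ zK).
have := UW (z, h) (conj Uz hW); rewrite /= /Lap -mulr_natr.
have : dl * (n%:R + 1) = gapv / 4.
  by rewrite /dl invfM mulrA divfK ?gt_eqF.
by move=> *; nra.
Unshelve. all: by end_near.
Qed.
End Bernstein.

(** * Vector fields of nonnegative divergence *)

Section Divergence.
Context {R : realType} {n : nat}.
Local Notation V := 'rV[R]_n.
Implicit Types (f g : V -> R) (x y v w : V) (t h : R).

Section Grid.
Variables (N : nat) (a h : R).
Local Notation grid_index := {ffun 'I_n -> 'I_N.+1}.

Definition grid_pt (k : grid_index) : V := \row_i (a + h * (k i)%:R).

(** The cyclic shift in the direction [i] permutes the grid, which turns the
    telescoping of a sum of increments into a reindexing. *)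
Definition grid_shift (i : 'I_n) (k : grid_index) : grid_index :=
  [ffun j => if j == i then ordS (k j) else k j].

Lemma grid_shift_inj i : injective (grid_shift i).
Proof.
move=> k l /ffunP E; apply/ffunP => j; have := E j; rewrite !ffunE.
by case: eqP => // _ /ordS_inj.
Qed.

Lemma grid_pt_shift i (k : grid_index) : k i != ord_max ->
  grid_pt (grid_shift i k) = h *: 'e_i + grid_pt k.
Proof.
move=> ki; apply/rowP => j; rewrite !mxE ffunE eqxx /=.
have [->|ji] := eqVneq j i; last by rewrite mulr0 add0r.
have kN : ((k i).+1 < N.+1)%N.
  by rewrite ltn_neqAle ltn_ord andbT eqSS; apply: contra ki => /eqP E; apply/eqP/val_inj.
by rewrite /ordS /= modn_small // -natr1; ring.
Qed.

(** Both sides are the product over the coordinates of the number of admissible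
    indices. *)
Lemma grid_last_card i :
  \sum_(k : grid_index) (k i == ord_max)%:R = (N.+1%:R) ^+ n.-1 :> R.
Proof.
pose F (i' : 'I_n) (j : 'I_N.+1) : R := if i' == i then (j == ord_max)%:R else 1.
transitivity (\sum_(k : grid_index) \prod_i' F i' (k i')).
  apply: eq_bigr => k _; rewrite (bigD1 i) //= big1 ?mulr1 /F ?eqxx //.
  by move=> j /negbTE ->.
rewrite -bigA_distr_bigA (bigD1 i) //= {1}/F eqxx.
rewrite (bigD1 ord_max) //= eqxx big1 ?addr0 ?mul1r; last by move=> j /negbTE ->.
rewrite (eq_bigr (fun=> N.+1%:R)); last first.
  by move=> j /negbTE ji; rewrite /F ji sumr_const card_ord.
by rewrite prodr_const cardC1 card_ord.
Qed.

(** Summing over the shifted grid gives the same total as summing over the grid.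
    Away from the last layer the cyclic shift is the translation by [h] in
    direction [i], so only the last layer contributes; there both points lie on
    faces of the cube. *)
Lemma grid_telescope (g : V -> R) i (S : R) :
  a + h * N.+1%:R = - a -> a <= 0 ->
  (forall x, - a <= `|x 0 i| -> `|g x| <= S) ->
  \sum_(k : grid_index) (g (h *: 'e_i + grid_pt k) - g (grid_pt k))
    <= 2 * S * N.+1%:R ^+ n.-1.
Proof.
move=> ah a0 gS; rewrite big_split /= sumrN [X in _ - X](reindex_inj (@grid_shift_inj i)) /=.
rewrite -sumrB -(grid_last_card i) mulr_sumr; apply: ler_sum => k _.
have [kl|kl] := eqVneq (k i) ord_max; last by rewrite grid_pt_shift // subrr mulr0.
rewrite mulr1; apply: le_trans (ler_norm _) _; apply: le_trans (ler_normB _ _) _.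
rewrite mulr2n mulrDl mul1r; apply: lerD; apply: gS.
  have -> : (h *: 'e_i + grid_pt k) 0 i = a + h * N.+1%:R.
    by rewrite !mxE !eqxx kl /= -natr1; ring.
  by rewrite ah ger0_norm // oppr_ge0.
rewrite !mxE ffunE eqxx kl /ordS /= modnn mulr0 addr0.
by rewrite ler0_norm.
Qed.

(** The integral part of [d / h] is a number of consecutive grid points between
    [c] and [c + d], and it is at least half of [d / h] because [d / h >= 1]. *)
Lemma grid_count1 (c d : R) : 0 < h -> h <= d -> a <= c - d -> c + d < a + h * N.+1%:R ->
  d / h / 2 <= \sum_(j < N.+1) ((`|a + h * j%:R - c| <= d)%R)%:R :> R.
Proof.
move=> h0 hd acd cda.
pose t := (c - a) / h; pose s := d / h.
have s1 : 1 <= s by rewrite ler_pdivlMr // mul1r.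
have t0 : 0 <= t by rewrite divr_ge0 // ?ltW //; lra.
have tN : t + s < N.+1%:R by rewrite -mulrDl ltr_pdivrMr // mulrC; lra.
pose q := Num.truncn s; pose j0 := (Num.truncn t).+1.
have qs : q%:R <= s by rewrite truncn_le; lra.
have sq : s < q.+1%:R by exact: truncnS_gt.
have j0t : j0%:R <= t + 1 by rewrite -natr1 lerD2r truncn_le.
have tj0 : t < j0%:R by exact: truncnS_gt.
have sE : d / h / 2 <= q%:R.
  rewrite -/s; have q1 : (1 <= q)%N by rewrite truncn_ge_nat; lra.
  have : 1 <= q%:R :> R by rewrite ler1n.
  move: sq; rewrite -natr1; lra.
apply: le_trans sE _.
have jN (l : 'I_q) : (j0 + l < N.+1)%N.
  rewrite -(ltr_nat R) natrD.
  have : l%:R + 1 <= q%:R :> R by rewrite natr1 ler_nat ltn_ord.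
  lra.
pose f (l : 'I_q) : 'I_N.+1 := Ordinal (jN l).
have finj : injective f by move=> l m [] /addnI /val_inj.
rewrite -[q]card_ord -(card_imset _ finj) -sum1_card natr_sum.
rewrite big_mkcond /=; apply: ler_sum => j _.
case: imsetP => [[l _ ->]|_]; last exact: ler0n.
suff H : `|a + h * (f l)%:R - c| <= d by rewrite H.
have lq : l%:R + 1 <= q%:R :> R by rewrite natr1 ler_nat ltn_ord.
have -> : a + h * (j0 + l)%:R - c = h * ((j0 + l)%:R - t).
  by rewrite mulrBr /t [h * (_ / _)]mulrCA divff ?gt_eqF // mulr1; ring.
rewrite natrD normrM gtr0_norm // -ler_pdivlMl // mulrC -/s ler_norml.
have : 0 <= l%:R :> R by exact: ler0n.
by move=> ?; apply/andP; split; lra.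
Qed.
End Grid.

Lemma norm_le_of_coord x r : 0 <= r -> (forall i, `|x 0 i| <= r) -> `|x| <= r.
Proof.
move=> r0 H; rewrite [leLHS]/Num.norm /= mx_normrE.
by apply/bigmax_leP; split=> // -[i j] _ /=; rewrite (ord1 i).
Qed.

(** The divergence theorem on the cube of half-side [M], in Riemann sum form.
    The flux through the boundary is at most a constant times [M^(n-1) M^(-n)],
    which is small for large [M], while the sum of the divergence is bounded
    below by a positive constant independent of [M] as soon as the divergence is
    positive at one point. The mesh is chosen after [M]. *)
Theorem divergence_ge0_eq0 (W dW : 'I_n -> V -> R) (K : R) :
  (0 < n)%N ->
  (forall i x, is_derive x 'e_i (W i) (dW i x)) ->
  (forall i, continuous (dW i)) ->
  (forall i x, `|W i x| * `|x| ^+ n <= K) ->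
  (forall x, 0 <= \sum_i dW i x) ->
  forall x, \sum_i dW i x = 0.
Proof.
move=> n0 HW cdW HK D0 x0; apply/eqP; rewrite eq_le D0 andbT leNgt; apply/negP.
move=> Dx0; pose D x := \sum_i dW i x.
pose c := D x0 / 2.
have c0 : 0 < c by rewrite divr_gt0.
have [dl dl0 Hdl] : exists2 dl : R, 0 < dl & forall x, `|x - x0| <= dl -> c <= D x.
  have : \forall x \near x0, c < D x.
    have cD : D y @[y --> x0] --> D x0 by apply: (cvg_fin_sum (F := nbhs x0)) => i; apply: cdW.
    move/cvgr_gt : cD; apply; rewrite ltr_pdivrMr // ltr_pMr // ltr1n //.
  move=> /nbhs_ballP[r /= r0 Hr]; exists (r / 2); first by rewrite divr_gt0.
  move=> x xr; apply: ltW; apply: Hr; rewrite -ball_normE /= distrC.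
  by apply: le_lt_trans xr _; rewrite ltr_pdivrMr // ltr_pMr // ltr1n.
have K0 : 0 <= K.
  by apply: le_trans (HK (Ordinal n0) 0); rewrite mulr_ge0 // exprn_ge0.
pose A := c * (dl / 2) ^+ n.
have A0 : 0 < A by rewrite mulr_gt0 // exprn_gt0 // divr_gt0.
pose Q := n%:R * 2 ^+ n * K * 4 / A.
have Q0 : 0 <= Q by apply: divr_ge0; [rewrite !mulr_ge0 // exprn_ge0|exact: ltW].
pose M := `|x0| + dl + 1 + Q.
have x00 : 0 <= `|x0| by [].
have M0 : 0 < M by rewrite /M; lra.
(* [A] bounds the Riemann sum from below; the flux and the discretisation error
   are each made at most [A / 4], the former by [M], the latter by [ep]. *)
pose ep := A / (4 * (n%:R * (2 * M) ^+ n + 1)).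
have nM0 : 0 < n%:R * (2 * M) ^+ n + 1.
  by rewrite ltr_wpDl // mulr_ge0 // exprn_ge0 // ltW // mulr_gt0.
have ep0 : 0 < ep by rewrite divr_gt0 // mulr_gt0.
pose dq i (y : V) (h : R) := h^-1 * (W i (h *: 'e_i + y) - W i y).
have unif : \forall h \near (0 : R)^', [set y : V | `|y - 0| <= M] `<=` (fun y =>
     forall i, `|dq i y h - dW i y| < ep).
  have /compact_near_coveringP := @closed_box_compact R n 0 M.
  apply => y Ky.
  suff : \forall p \near filter_prod (nbhs y) (0:R)^', forall i,
      `|dq i p.1 p.2 - dW i p.1| < ep.
    move=> [[U' W'] /= [U'y W'0] UW'].
    by exists (U', W') => // -[y' h] /= [yU hW]; exact: (UW' (y', h)).
  apply: (@filter_forall (V * R) _ (fun i => [set p | `|dq i p.1 p.2 - dW i p.1| < ep])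
     (filter_prod (nbhs y) (0:R)^')) => i.
  suff : (fun p : V * R => dq i p.1 p.2 - dW i p.1) @ filter_prod (nbhs y) (0:R)^'
     --> dW i y - dW i y.
    by rewrite subrr => /cvgr0_norm_lt/(_ _ ep0).
  apply: cvgB; first by apply: cvg_difference_quotient => //; apply: cdW.
  by apply: (cvg_comp _ _ (cvg_fst (G := (0:R)^'))); exact: cdW.
have [eta /= eta0 Heta] := unif.
pose N := Num.truncn (2 * M / Num.min eta dl).
pose h := 2 * M / N.+1%:R.
have N0 : 0 < N.+1%:R :> R by [].
have h0 : 0 < h by rewrite divr_gt0 // mulr_gt0.
have mi0 : 0 < Num.min eta dl by rewrite lt_min eta0.
have : h < Num.min eta dl.
  by rewrite ltr_pdivrMr // [ltRHS]mulrC -ltr_pdivrMr //; exact: truncnS_gt.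
rewrite lt_min => /andP[heta hdl].
have hN : h * N.+1%:R = 2 * M by rewrite divfK // gt_eqF.
clearbody h.
have aN : - M + h * N.+1%:R = - - M by rewrite hN; ring.
have zM (k : {ffun 'I_n -> 'I_N.+1}) : `|grid_pt (- M) h k| <= M.
  apply: norm_le_of_coord => [|i]; first exact: ltW.
  rewrite mxE ler_norml; apply/andP; split.
    by rewrite lerDl mulr_ge0 // ltW.
  have : h * (k i)%:R <= h * N.+1%:R by rewrite ler_pM2l // ler_nat ltnW.
  by rewrite hN; lra.
pose P i (j : 'I_N.+1) : R := ((`|- M + h * j%:R - x0 0 i| <= dl)%R)%:R.
have low (k : {ffun 'I_n -> 'I_N.+1}) :
    c * (\prod_i P i (k i)) - n%:R * ep <= \sum_i dq i (grid_pt (- M) h k) h.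
  set z := grid_pt _ _ _.
  apply: (@le_trans _ _ (D z - n%:R * ep)).
    rewrite lerD2r.
    have [/forallP allP|] := boolP [forall i, (`|- M + h * (k i)%:R - x0 0 i| <= dl)%R].
      rewrite big1 ?mulr1; last by move=> i _; rewrite /P allP.
      apply: Hdl; apply: norm_le_of_coord => [|i]; first exact: ltW.
      by rewrite !mxE; apply: allP.
    rewrite negb_forall => /existsP[i iP].
    by rewrite (bigD1 i) //= {1}/P (negbTE iP) mul0r mulr0 D0.
  rewrite -[n in n%:R * _]card_ord mulr_natl -sumr_const -sumrB; apply: ler_sum => i _.
  have : `|dq i z h - dW i z| < ep.
    apply: (Heta h) => /=; last by rewrite subr0 zM.
      by rewrite sub0r normrN gtr0_norm.
    by rewrite gt_eqF.
  by rewrite ltr_norml => /andP[]; lra.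
have lowsum : c * (dl / h / 2) ^+ n - n%:R * ep * N.+1%:R ^+ n <=
   \sum_(k : {ffun 'I_n -> 'I_N.+1}) \sum_i dq i (grid_pt (- M) h k) h.
  apply: (@le_trans _ _ (\sum_(k : {ffun 'I_n -> 'I_N.+1})
      (c * (\prod_i P i (k i)) - n%:R * ep))); last by apply: ler_sum.
  rewrite big_split /= sumr_const card_ffun !card_ord -mulr_sumr -bigA_distr_bigA /=.
  rewrite -[X in _ <= _ + X]mulr_natr natrX mulNr lerD2r.
  rewrite ler_pM2l // -[in X in X <= _](card_ord n) -prodr_const.
  apply: ler_prod => i _; apply/andP; split.
    by apply: divr_ge0 => //; apply: divr_ge0; exact: ltW.
  have xi := coord_le_norm x0 i.
  move: xi; rewrite ler_norml => /andP[xi1 xi2].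
  apply: grid_count1 => //; rewrite ?hN /M; lra.
pose S := K / M ^+ n.
have Mn0 : 0 < M ^+ n by rewrite exprn_gt0.
have up : \sum_(k : {ffun 'I_n -> 'I_N.+1}) \sum_i dq i (grid_pt (- M) h k) h
   <= h^-1 * (n%:R * (2 * S * N.+1%:R ^+ n.-1)).
  rewrite exchange_big /= -[n in n%:R * _]card_ord mulr_natl -sumr_const mulr_sumr.
  apply: ler_sum => i _.
  rewrite /dq -mulr_sumr ler_pM2l ?invr_gt0 //.
  apply: grid_telescope => //; first by rewrite oppr_le0 ltW.
  move=> x; rewrite opprK => Mx.
  rewrite ler_pdivlMr //; apply: le_trans (HK i x); rewrite ler_wpM2l //.
  apply: lerXn2r; rewrite ?nnegrE //; first exact: ltW.
  by apply: le_trans Mx _; exact: coord_le_norm.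
have := le_trans lowsum up.
have hn0 : 0 < h ^+ n by rewrite exprn_gt0.
rewrite -(ler_pM2l hn0) mulrBr.
have -> : h ^+ n * (c * (dl / h / 2) ^+ n) = A.
  rewrite /A mulrCA -exprMn; congr (_ * _ ^+ _).
  by field; rewrite gt_eqF.
have -> : h ^+ n * (n%:R * ep * N.+1%:R ^+ n) = ep * (n%:R * (2 * M) ^+ n).
  rewrite -hN exprMn; move: (h ^+ n) (N.+1%:R ^+ n) => a b. by ring.
have -> : h ^+ n * (h^-1 * (n%:R * (2 * S * N.+1%:R ^+ n.-1))) = n%:R * 2 ^+ n * K / M.
  transitivity (n%:R * 2 * S * (2 * M) ^+ n.-1).
    have -> : h ^+ n = h * h ^+ n.-1 by rewrite -exprS prednK.
    rewrite -hN exprMn; move: (h ^+ n.-1) (N.+1%:R ^+ n.-1) => a b.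
    by field; rewrite gt_eqF.
  have E (t : R) : t ^+ n = t * t ^+ n.-1 by rewrite -exprS prednK.
  have Mm0 : M ^+ n.-1 != 0 by rewrite expf_neq0 // gt_eqF.
  rewrite /S exprMn !E; move: (2 ^+ n.-1) (M ^+ n.-1) Mm0 => a b b0.
  by field; rewrite b0 gt_eqF.
have : ep * (n%:R * (2 * M) ^+ n) <= A / 4.
  have <- : ep * (n%:R * (2 * M) ^+ n + 1) = A / 4.
    rewrite /ep; move: (_ + 1) nM0 => t t0; field; by rewrite gt_eqF.
  by rewrite ler_pM2l // lerDl.
have : n%:R * 2 ^+ n * K / M <= A / 4.
  rewrite ler_pdivrMr //.
  have -> : n%:R * 2 ^+ n * K = A / 4 * Q by rewrite /Q; field; rewrite gt_eqF.
  by rewrite ler_pM2l ?divr_gt0 // /M; lra.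
by move=> *; lra.
Qed.
End Divergence.

(** * Powers, closure properties and polynomial growth *)

Section AbsPower.
Context {R : realType}.
Implicit Types (q s t : R).

Lemma continuous_abs_powR q : 0 < q -> continuous (fun s : R => `|s| `^ q).
Proof.
move=> q0 t; have [->|t0] := eqVneq t 0.
  apply/cvgrPdist_lt => e e0.
  rewrite normr0 powR0 ?gt_eqF //.
  near=> s; rewrite sub0r normrN ger0_norm ?powR_ge0 //.
  have -> : e = (e `^ q^-1) `^ q by rewrite -powRrM mulVf ?gt_eqF // powRr1 ?ltW.
  apply: gt0_ltr_powR; rewrite ?nnegrE ?powR_ge0 //.
  near: s; apply/nbhs_ballP; exists (e `^ q^-1); first by rewrite /= powR_gt0.
  by move=> s; rewrite /ball /= sub0r normrN.
have nt : 0 < `|t| by rewrite normr_gt0.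
apply: (@continuous_comp _ _ _ (@Num.norm _ R) (fun s => s `^ q)).
  exact: norm_continuous.
apply/differentiable_continuous; rewrite -derivable1_diffP.
by have [] := is_derive1_powR q nt.
Unshelve. all: by end_near.
Qed.

(** The absolute value is there because [`^] takes the value 1 on the negative
    reals: with it the function is differentiable at 0 from both sides. *)
Lemma is_derive_abs_powR q t : 1 < q -> 0 <= t ->
  is_derive t (1 : R) (fun s : R => `|s| `^ q) (q * t `^ (q - 1)).
Proof.
move=> q1; rewrite le_eqVlt => /predU1P[<-|t0].
  have q10 : 0 < q - 1 by rewrite subr_gt0.
  rewrite powR0 ?gt_eqF // mulr0.
  have lim0 : (fun h : R => h^-1 *: (((fun s : R => `|s| `^ q) \o shift 0) (h *: (1:R))
      - `|0 : R| `^ q)) @ 0^' --> (0 : R).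
    apply/cvgr0Pnorm_lt => e e0.
    have := @continuous_abs_powR _ q10 0.
    rewrite /continuous_at normr0 powR0 ?gt_eqF // => /cvgr0Pnorm_lt/(_ e e0).
    move=> /nbhs_ballP[r /= r0 Hr].
    exists r => // h hr h0; move: (Hr h hr) => /=.
    rewrite addr0 powR0 ?subr0 ?gt_eqF ?(lt_trans ltr01) //.
    have -> : h *: (1 : R) = h by exact: mulr1.
    rewrite ger0_norm ?powR_ge0 // => H.
    rewrite normrM normfV (ger0_norm (powR_ge0 _ _)).
    rewrite -(@mulr_powRB1 _ `|h|) ?(lt_trans ltr01) // mulKf ?normr_eq0 //.
  by apply: DeriveDef; [apply/cvg_ex; exists 0|apply: cvg_lim lim0].
apply: (@near_eq_is_derive _ _ _ (fun s : R => s `^ q)).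
  near=> s; rewrite gtr0_norm //; near: s.
  exact: lt_nbhsr.
exact: is_derive1_powR.
Unshelve. all: by end_near.
Qed.
End AbsPower.

Section Closure.
Context {R : realType} {n : nat}.
Local Notation V := 'rV[R]_n.
Implicit Types (f g : V -> R) (x y v w : V) (t h : R).

Lemma is_deriveDf f g x v a b : is_derive x v f a -> is_derive x v g b ->
  is_derive x v (fun y => f y + g y) (a + b).
Proof. exact: is_deriveD. Qed.

Lemma is_deriveBf f g x v a b : is_derive x v f a -> is_derive x v g b ->
  is_derive x v (fun y => f y - g y) (a - b).
Proof. exact: is_deriveB. Qed.

Lemma is_deriveMf f g x v a b : is_derive x v f a -> is_derive x v g b ->
  is_derive x v (fun y => f y * g y) (a * g x + f x * b).
Proof.
move=> H1 H2; have := is_deriveM H1 H2.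
by rewrite /GRing.scale /= addrC [g x * a]mulrC.
Qed.

Lemma is_deriveZf f x v a c : is_derive x v f a -> is_derive x v (fun y => c * f y) (c * a).
Proof. exact: (@is_deriveZ _ _ _ f). Qed.

Lemma is_derive_coord_basis x i j : is_derive x 'e_j (fun y : V => y 0 i) (i == j)%:R.
Proof. by have := @is_derive_coord R n x 'e_j i; rewrite mxE eqxx. Qed.

Lemma ctsD f g x : {for x, continuous f} -> {for x, continuous g} ->
  {for x, continuous (fun y => f y + g y)}.
Proof. by move=> cf cg; exact: (cvgD (F := nbhs x) cf cg). Qed.

Lemma ctsB f g x : {for x, continuous f} -> {for x, continuous g} ->
  {for x, continuous (fun y => f y - g y)}.
Proof. by move=> cf cg; exact: (cvgB (F := nbhs x) cf cg). Qed.

Lemma ctsM f g x : {for x, continuous f} -> {for x, continuous g} ->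
  {for x, continuous (fun y => f y * g y)}.
Proof. by move=> cf cg; exact: (cvgM (F := nbhs x) cf cg). Qed.

Lemma ctsN f x : {for x, continuous f} -> {for x, continuous (fun y => - f y)}.
Proof. by move=> cf; exact: (cvgN (F := nbhs x) cf). Qed.

Lemma cts_cst (c : R) x : {for x, continuous (fun _ : V => c)}.
Proof. exact: cst_continuous. Qed.

Lemma cts_coord x i : {for x, continuous (fun y : V => y 0 i)}.
Proof. exact: coord_continuous. Qed.

Lemma cts_sum (I : finType) (f : I -> V -> R) x : (forall i, {for x, continuous (f i)}) ->
  {for x, continuous (fun y => \sum_i f i y)}.
Proof. by move=> cf; apply: (cvg_fin_sum (F := nbhs x)). Qed.

Lemma cts_comp (g : R -> R) f x : {for f x, continuous g} -> {for x, continuous f} ->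
  {for x, continuous (fun y => g (f y))}.
Proof. by move=> cg cf; apply: continuous_comp cf cg. Qed.

Definition sqnorm (x : V) : R := \sum_i x 0 i ^+ 2.

Lemma sqnorm_ge0 x : 0 <= sqnorm x.
Proof. by apply: sumr_ge0 => i _; apply: sqr_ge0. Qed.

Lemma coord_sqnorm_le x i : x 0 i ^+ 2 <= sqnorm x.
Proof. by rewrite /sqnorm (bigD1 i) //= lerDl sumr_ge0 // => j _; apply: sqr_ge0. Qed.

Lemma norm_sqnorm_le x : `|x| ^+ 2 <= sqnorm x.
Proof.
have [x0|] := eqVneq (mx_norm x) 0.
  by rewrite [`|x|]x0 expr0n sqnorm_ge0.
move=> /mx_norm_neq0[[i k]] /= E.
by rewrite [`|x|]E (ord1 i) real_normK ?num_real // coord_sqnorm_le.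
Qed.

Lemma is_derive_sqnorm x i : is_derive x 'e_i sqnorm (2 * x 0 i).
Proof.
have -> : 2 * x 0 i = \sum_k 2 * x 0 k * (k == i)%:R.
  rewrite (bigD1 i) //= big1 ?addr0 ?eqxx ?mulr1 // => k /negbTE ->.
  by rewrite mulr0.
by apply: is_derive_bigsum => k; apply: is_derive_sqr; apply: is_derive_coord_basis.
Qed.

Lemma cts_sqnorm x : {for x, continuous sqnorm}.
Proof.
apply: cts_sum => i; apply: (cvg_sqr (F := nbhs x)); exact: cts_coord.
Qed.

(** The exponent is a natural number and the base is [1 + |x|^2], which is
    smooth and at least 1, so that exponents can be increased freely. *)
Definition polygrowth f := exists2 C : R, 0 <= C & exists m, forall x,
  `|f x| <= C * (1 + sqnorm x) ^+ m.

Lemma polygrowth_cst c : polygrowth (fun=> c).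
Proof. by exists `|c| => //; exists 0%N => x; rewrite expr0 mulr1. Qed.

Lemma polygrowth_le f g : (forall x, `|f x| <= `|g x|) -> polygrowth g -> polygrowth f.
Proof. by move=> fg [C C0 [m H]]; exists C => //; exists m => x; apply: le_trans (H x). Qed.

Lemma sqnorm_ge1 x : 1 <= 1 + sqnorm x.
Proof. by rewrite lerDl sqnorm_ge0. Qed.

Lemma polygrowthD f g : polygrowth f -> polygrowth g -> polygrowth (fun x => f x + g x).
Proof.
move=> [C C0 [m Hf]] [D D0 [k Hg]]; exists (C + D); first exact: addr_ge0.
exists (m + k)%N => x; apply: le_trans (ler_normD _ _) _; rewrite mulrDl.
apply: lerD.
  by apply: le_trans (Hf x) _; rewrite ler_wpM2l // ler_weXn2l ?leq_addr // sqnorm_ge1.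
by apply: le_trans (Hg x) _; rewrite ler_wpM2l // ler_weXn2l ?leq_addl // sqnorm_ge1.
Qed.

Lemma polygrowthM f g : polygrowth f -> polygrowth g -> polygrowth (fun x => f x * g x).
Proof.
move=> [C C0 [m Hf]] [D D0 [k Hg]]; exists (C * D); first exact: mulr_ge0.
by exists (m + k)%N => x; rewrite normrM exprD mulrACA ler_pM.
Qed.

Lemma polygrowthN f : polygrowth f -> polygrowth (fun x => - f x).
Proof. by apply: polygrowth_le => x; rewrite normrN. Qed.

Lemma polygrowthB f g : polygrowth f -> polygrowth g -> polygrowth (fun x => f x - g x).
Proof. by move=> pf pg; apply: polygrowthD => //; apply: polygrowthN. Qed.

Lemma polygrowthX f k : polygrowth f -> polygrowth (fun x => f x ^+ k).
Proof.
move=> pf; elim: k => [|k IH]; first by under eq_fun do rewrite expr0; exact: polygrowth_cst.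
by under eq_fun do rewrite exprS; exact: polygrowthM.
Qed.

Lemma polygrowth_sum (I : finType) (f : I -> V -> R) :
  (forall i, polygrowth (f i)) -> polygrowth (fun x => \sum_i f i x).
Proof.
move=> pf; suff H (s : seq I) : polygrowth (fun x => \sum_(i <- s) f i x) by exact: H.
elim: s => [|i s IH]; first by under eq_fun do rewrite big_nil; exact: polygrowth_cst.
by under eq_fun do rewrite big_cons; exact: polygrowthD.
Qed.

Lemma polygrowth_norm : polygrowth (fun x => `|x|).
Proof.
exists 1 => //; exists 1%N => x; rewrite mul1r expr1 normr_id.
have := norm_sqnorm_le x; have := sqr_ge0 (`|x| - 1); nra.
Qed.

Lemma polygrowth_coord i : polygrowth (fun x => x 0 i).
Proof. by apply: polygrowth_le polygrowth_norm => x; rewrite normr_id coord_le_norm. Qed.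

(** From [1 + t <= exp t], applied to [t = |x|^2 / (4 (m+1))] and raised to the
    power [m+1]. *)
Lemma gaussian_polygrowth_bounded f : polygrowth f ->
  exists K, forall x, `|expR (- (4^-1 * sqnorm x)) * f x| <= K.
Proof.
move=> [C C0 [m H]]; exists (C * (4 * m.+1%:R) ^+ m.+1) => x.
rewrite normrM ger0_norm ?expR_ge0 // expRN ler_pdivrMl ?expR_gt0 //.
apply: le_trans (H x) _; rewrite mulrCA ler_wpM2l //.
apply: (@le_trans _ _ ((1 + sqnorm x) ^+ m.+1)).
  by rewrite ler_weXn2l // sqnorm_ge1.
have m0 : 0 < 4 * m.+1%:R :> R by rewrite mulr_gt0.
have -> : 4^-1 * sqnorm x = m.+1%:R * (sqnorm x / (4 * m.+1%:R)).
  by field; rewrite nat1r pnatr_eq0.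
rewrite expRM_natl -exprMn; apply: lerXn2r; rewrite ?nnegrE.
- by rewrite addr_ge0 // sqnorm_ge0.
- by rewrite mulr_ge0 ?expR_ge0 // ltW.
rewrite -ler_pdivrMr //; apply: le_trans (expR_ge1Dx _).
rewrite mulrDl mul1r lerD2r invf_le1 //.
have : 1 <= m.+1%:R :> R by rewrite ler1n.
lra.
Qed.
End Closure.

(** * The Pohozaev identity of Giga and Kohn *)

Section Profile.
Context {R : realType} {n : nat}.
Local Notation V := 'rV[R]_n.
Implicit Types (x y v w : V) (t h : R).

Section C2calculus.
Context (u : V -> R) (uC2 : C2 u).
Local Notation u1 := (fun i => partial i u).
Local Notation u2 := (fun i j => partial j (partial i u)).

Lemma C2_cts x : {for x, continuous u}.
Proof. by case: uC2 => + _ _; apply. Qed.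

Lemma C2_cts_partial i x : {for x, continuous (partial i u)}.
Proof. by case: uC2 => _ /(_ i)[_ +] _; apply. Qed.

Lemma C2_cts_partial2 i j x : {for x, continuous (partial j (partial i u))}.
Proof. by case: uC2 => _ _ /(_ i j)[_]; apply. Qed.

Lemma C2_is_derive i x : is_derive x 'e_i u (partial i u x).
Proof. by case: uC2 => _ /(_ i)[+ _] _ => /(_ x)/derivableP. Qed.

Lemma C2_is_derive_partial i j x : is_derive x 'e_j (partial i u) (partial j (partial i u) x).
Proof. by case: uC2 => _ _ /(_ i j)[+ _] => /(_ x)/derivableP. Qed.

Lemma C2_partial_sym i j x : partial j (partial i u) x = partial i (partial j u) x.
Proof.
apply: (@derive_comm R n u (fun v => 'D_v u) (fun v w => 'D_w ('D_v u)) 'e_i 'e_j x).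
- by move=> y; apply: C2_is_derive.
- by move=> y; apply: C2_is_derive.
- by move=> y; apply: C2_is_derive_partial.
- by move=> y; apply: C2_is_derive_partial.
- by apply: C2_cts_partial2.
- by apply: C2_cts_partial2.
Qed.
End C2calculus.

Context (p : R) (u : V -> R).
Hypotheses (p1 : 1 < p) (u0 : forall x, 0 <= u x).
Hypothesis sol : classical_solution p (1 / (p - 1)) u.
Local Notation beta := (1 / (p - 1)).

Let uC2 : C2 u. Proof. by case: sol. Qed.

Let p0 : 0 < p. Proof. exact: lt_trans p1. Qed.
Let p10 : 0 < p + 1. Proof. exact: addr_gt0. Qed.
Let pm0 : p - 1 != 0. Proof. by rewrite subr_eq0 gt_eqF. Qed.
Let pp0 : p + 1 != 0. Proof. by rewrite gt_eqF // addr_gt0 // (lt_trans ltr01). Qed.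

Definition radial_deriv x := \sum_k x 0 k * partial k u x.
Definition sqgrad x := \sum_k partial k u x ^+ 2.

(** The nonlinearity is rewritten as [|u|^p], which is legitimate for
    nonnegative [u] and is differentiable as a function of [x] even where [u]
    vanishes. *)
Lemma laplacianE x :
  laplacian u x = 2^-1 * radial_deriv x - `|u x| `^ p + beta * u x.
Proof.
have := sol.2 x; have -> : dotv x (grad u x) = radial_deriv x.
  by apply: eq_bigr => k _; rewrite mxE.
have -> : `|u x| `^ (p - 1) * u x = `|u x| `^ p.
  by rewrite -{2}(ger0_norm (u0 x)) mulrC mulr_powRB1 // (lt_trans ltr01).
by move=> H; lra.
Qed.

Lemma is_derive_upow q x i : 1 < q ->
  is_derive x 'e_i (fun y => `|u y| `^ q) (q * `|u x| `^ (q - 1) * partial i u x).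
Proof.
move=> q1; rewrite ger0_norm //.
apply: (@is_derive_comp _ _ (fun s : R => `|s| `^ q)); last exact: C2_is_derive.
exact: is_derive_abs_powR.
Qed.

Lemma cts_upow q x : 0 < q -> {for x, continuous (fun y => `|u y| `^ q)}.
Proof.
move=> q0; apply: (@cts_comp _ _ (fun s : R => `|s| `^ q)); last exact: C2_cts.
exact: continuous_abs_powR.
Qed.

Lemma is_derive_radial_deriv x i :
  is_derive x 'e_i radial_deriv (partial i u x + \sum_k x 0 k * partial i (partial k u) x).
Proof.
have -> : partial i u x + \sum_k x 0 k * partial i (partial k u) x
  = \sum_k ((k == i)%:R * partial k u x + x 0 k * partial i (partial k u) x).
  rewrite big_split /=; congr (_ + _).
  rewrite (bigD1 i) //= eqxx mul1r big1 ?addr0 // => k /negbTE ->.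
  by rewrite mul0r.
apply: is_derive_bigsum => k; apply: is_deriveMf; [exact: is_derive_coord_basis|exact: C2_is_derive_partial].
Qed.

Lemma is_derive_sqgrad x i :
  is_derive x 'e_i sqgrad (2 * \sum_k partial k u x * partial i (partial k u) x).
Proof.
rewrite mulr_sumr; apply: is_derive_bigsum => k; rewrite mulrA.
by apply: is_derive_sqr; apply: C2_is_derive_partial.
Qed.

Lemma cts_radial_deriv x : {for x, continuous radial_deriv}.
Proof.
by apply: cts_sum => k; apply: ctsM; [exact: cts_coord|exact: C2_cts_partial].
Qed.

Lemma cts_sqgrad x : {for x, continuous sqgrad}.
Proof.
by apply: cts_sum => k; apply: (cvg_sqr (F := nbhs x)); exact: C2_cts_partial.
Qed.

Local Notation q := (p + 1)^-1.

(** A primitive in [u] of [beta u - u^p]. *)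
Definition potential x := beta / 2 * u x ^+ 2 - q * `|u x| `^ (p + 1).

(** The combination of the fields [(x.grad u) grad u - |grad u|^2 x / 2], the
    potential times [x], [u grad u], [|x|^2 u grad u] and [u^2 x] in which all
    terms free of [grad u] cancel from the weighted divergence. *)
Definition pohozaev_field i x :=
  radial_deriv x * partial i u x - 2^-1 * sqgrad x * x 0 i - potential x * x 0 i
  + q * ((n%:R - 2^-1 * sqnorm x) * (u x * partial i u x) + 2^-1 * u x ^+ 2 * x 0 i).

Definition dpotential i x := (beta * u x - `|u x| `^ p) * partial i u x.

Definition dpohozaev_field i x :=
  (partial i u x + \sum_k x 0 k * partial i (partial k u) x) * partial i u x
  + radial_deriv x * partial i (partial i u) x
  - ((\sum_k partial k u x * partial i (partial k u) x) * x 0 i + 2^-1 * sqgrad x)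
  - (dpotential i x * x 0 i + potential x)
  + q * ((- x 0 i) * (u x * partial i u x)
         + (n%:R - 2^-1 * sqnorm x) * (partial i u x ^+ 2 + u x * partial i (partial i u) x)
         + (u x * partial i u x * x 0 i + 2^-1 * u x ^+ 2)).

Lemma is_derive_potential x i : is_derive x 'e_i potential (dpotential i x).
Proof.
apply: is_derive_eq.
  apply: is_deriveBf; apply: is_deriveZf; first by apply: is_derive_sqr; apply: C2_is_derive.
  by apply: is_derive_upow; rewrite ltrDr (lt_trans ltr01).
rewrite /dpotential addrK; field.
by rewrite pm0 pp0.
Qed.

Lemma is_derive_pohozaev_field x i : is_derive x 'e_i (pohozaev_field i) (dpohozaev_field i x).
Proof.
apply: is_derive_eq.
  apply: is_deriveDf; first apply: is_deriveBf; first apply: is_deriveBf.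
  - apply: is_deriveMf; [exact: is_derive_radial_deriv|exact: C2_is_derive_partial].
  - apply: is_deriveMf; [apply: is_deriveZf; exact: is_derive_sqgrad|exact: is_derive_coord_basis].
  - apply: is_deriveMf; [exact: is_derive_potential|exact: is_derive_coord_basis].
  - apply: is_deriveZf; apply: is_deriveDf; apply: is_deriveMf.
    + by apply: is_deriveBf; apply: is_deriveZf; exact: is_derive_sqnorm.
    + by apply: is_deriveMf; [exact: C2_is_derive|exact: C2_is_derive_partial].
    + by apply: is_deriveZf; apply: is_derive_sqr; exact: C2_is_derive.
    + exact: is_derive_coord_basis.
rewrite eqxx /dpohozaev_field /=; field.
by rewrite pp0.
Qed.

Lemma cts_potential x : {for x, continuous potential}.
Proof.
apply: ctsB; apply: ctsM; try exact: cts_cst; last exact: cts_upow.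
by apply: (cvg_sqr (F := nbhs x)); exact: C2_cts.
Qed.

Lemma cts_pohozaev_field i x : {for x, continuous (pohozaev_field i)}.
Proof.
have c0 := @C2_cts u uC2 x; have c1 := @C2_cts_partial u uC2 i x.
have cc := @cts_coord R n x i.
apply: ctsD; first apply: ctsB; first apply: ctsB.
- exact: ctsM (@cts_radial_deriv x) c1.
- exact: ctsM (ctsM (@cts_cst R n _ x) (@cts_sqgrad x)) cc.
- exact: ctsM (@cts_potential x) cc.
- apply: ctsM; first exact: cts_cst.
  apply: ctsD; apply: ctsM.
  + by apply: ctsB; [exact: cts_cst|apply: ctsM; [exact: cts_cst|exact: cts_sqnorm]].
  + exact: ctsM.
  + apply: ctsM; first exact: cts_cst.
    by apply: (cvg_sqr (F := nbhs x)).
  + exact: cc.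
Qed.

Lemma cts_dpohozaev_field i x : {for x, continuous (dpohozaev_field i)}.
Proof.
have c0 := @C2_cts u uC2 x; have c1 j := @C2_cts_partial u uC2 j x.
have c2 j := @C2_cts_partial2 u uC2 j i x.
have cc j := @cts_coord R n x j; have k := fun t => @cts_cst R n t x.
have cE := @cts_sqgrad x; have cR := @cts_radial_deriv x.
have cN := @cts_sqnorm R n x.
have csq (f : V -> R) (cf : {for x, continuous f}) : {for x, continuous (fun y => f y ^+ 2)}.
  by apply: (cvg_sqr (F := nbhs x)).
have cdP : {for x, continuous (dpotential i)}.
  apply: ctsM; last exact: c1.
  by apply: ctsB; [apply: ctsM => //; exact: cts_cst|exact: cts_upow].
have cS (f : 'I_n -> V -> R) (cf : forall j, {for x, continuous (f j)}) :=
  cts_sum (fun j => ctsM (cf j) (c2 j)).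
have t1 := ctsM (ctsD (c1 i) (cS _ cc)) (c1 i).
have t2 := ctsM cR (c2 i).
have t3 := ctsD (ctsM (cS _ c1) (cc i)) (ctsM (k 2^-1) cE).
have t4 := ctsD (ctsM cdP (cc i)) (@cts_potential x).
have t5 := ctsM (ctsN (cc i)) (ctsM c0 (c1 i)).
have t6 := ctsM (ctsB (k n%:R) (ctsM (k 2^-1) cN))
               (ctsD (csq _ (c1 i)) (ctsM c0 (c2 i))).
have t7 := ctsD (ctsM (ctsM c0 (c1 i)) (cc i)) (ctsM (k 2^-1) (csq _ c0)).
have := ctsD (ctsB (ctsB (ctsD t1 t2) t3) t4)
            (ctsM (k q) (ctsD (ctsD t5 t6) t7)).
by apply.
Qed.

(** The left-hand side is the divergence of the field with respect to the
    Gaussian weight [exp (- |x|^2 / 4)]. The terms in [x . D^2 u grad u] cancel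
    by symmetry of the Hessian, those in [x . grad u] by the equation, and those
    in [u^2] because [beta = 1 / (p - 1)]. *)
Lemma pohozaev_identity x :
  \sum_i (dpohozaev_field i x - 2^-1 * x 0 i * pohozaev_field i x) =
  sqgrad x * ((1 - n%:R / 2 + n%:R * q) + sqnorm x * (4^-1 - q / 2)).
Proof.
pose s i := \sum_k x 0 k * partial i (partial k u) x.
pose t i := \sum_k partial k u x * partial i (partial k u) x.
(* Each summand is a combination, with coefficients independent of [i], of seven
   expressions whose sums are known. *)
pose c0 := - 2^-1 * sqgrad x - potential x + q * (2^-1 * u x ^+ 2).
pose c1 := q * (n%:R - 2^-1 * sqnorm x) + 1.
pose c2 := radial_deriv x + q * (n%:R - 2^-1 * sqnorm x) * u x.
pose c3 := - (beta * u x - `|u x| `^ p) - 2^-1 * radial_deriv x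
           - 2^-1 * q * (n%:R - 2^-1 * sqnorm x) * u x.
pose c4 := 4^-1 * sqgrad x + 2^-1 * potential x - q * (4^-1 * u x ^+ 2).
transitivity (\sum_i (c0 + c1 * partial i u x ^+ 2 + s i * partial i u x
   + c2 * partial i (partial i u) x - t i * x 0 i
   + c3 * (x 0 i * partial i u x) + c4 * x 0 i ^+ 2)).
  apply: eq_bigr => i _.
  rewrite /dpohozaev_field /pohozaev_field -/(s i) -/(t i) /dpotential.
  rewrite /c0 /c1 /c2 /c3 /c4.
  by move: (q) (beta) => Q B; field.
have E : \sum_i t i * x 0 i = \sum_i s i * partial i u x.
  under eq_bigr => i _ do rewrite /t mulr_suml.
  under [RHS]eq_bigr => i _ do rewrite /s mulr_suml.
  rewrite exchange_big /=; apply: eq_bigr => i _; apply: eq_bigr => k _.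
  by rewrite (C2_partial_sym uC2 i k); ring.
have -> (d0 d1 d2 d3 d4 : R) : \sum_i (d0 + d1 * partial i u x ^+ 2
     + s i * partial i u x + d2 * partial i (partial i u) x - t i * x 0 i
     + d3 * (x 0 i * partial i u x) + d4 * x 0 i ^+ 2)
   = d0 * n%:R + d1 * sqgrad x + d2 * laplacian u x + d3 * radial_deriv x + d4 * sqnorm x.
  rewrite !big_split /= sumrN E -!mulr_sumr sumr_const card_ord mulr_natr.
  rewrite -/(sqgrad x) -/(radial_deriv x) -/(sqnorm x) -/(laplacian u x); ring.
rewrite laplacianE.
rewrite /c0 /c1 /c2 /c3 /c4 /potential.
have -> : `|u x| `^ (p + 1) = u x * `|u x| `^ p.
  by rewrite -[p in RHS](addrK 1) -{2}(ger0_norm (u0 x)) mulr_powRB1.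
field.
by rewrite pm0 pp0.
Qed.

(** The hypothesis on [n] and [p] is positivity of the constant [A] in the
    divergence [rho |grad u|^2 (A + B |x|^2)]; [B > 0] since [p > 1]. *)
Lemma pohozaev_rigidity :
  (0 < n)%N -> 0 < 1 - n%:R / 2 + n%:R * q ->
  polygrowth u -> (forall i, polygrowth (partial i u)) ->
  forall x, sqgrad x = 0.
Proof.
move=> n0 A0 pu pu1 x.
pose rho (y : V) := expR (- (4^-1 * sqnorm y)).
have B0 : 0 < 4^-1 - q / 2.
  have q2 : q < 2^-1 by rewrite ltf_pV2 ?posrE // -[2]/(1 + 1) ltrD2r.
  lra.
have AB y : 0 < 1 - n%:R / 2 + n%:R * q + sqnorm y * (4^-1 - q / 2).
  by rewrite ltr_pwDl // mulr_ge0 ?sqnorm_ge0 // ltW.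
have E0 y : 0 <= sqgrad y by apply: sumr_ge0 => i _; apply: sqr_ge0.
have drho i y : is_derive y 'e_i rho (- 2^-1 * y 0 i * rho y).
  apply: is_derive_eq.
    apply: (@is_derive_comp _ _ expR (fun y => - (4^-1 * sqnorm y))).
    apply: (@is_deriveN _ _ _ (fun y => 4^-1 * sqnorm y)).
    apply: is_deriveZf; exact: is_derive_sqnorm.
  by rewrite -/(rho y); field.
have crho y : {for y, continuous rho}.
  apply: (@cts_comp _ _ expR); first exact: continuous_expR.
  by apply: ctsN; apply: ctsM; [exact: cts_cst|exact: cts_sqnorm].
have pV i : polygrowth (pohozaev_field i).
  have pc := @polygrowth_coord R n.
  have ps : polygrowth (@sqnorm R n) by apply: polygrowth_sum => k; apply: polygrowthX.
  have pup : polygrowth (fun y => `|u y| `^ (p + 1)).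
    apply: (@polygrowth_le _ _ _ (fun y => (1 + u y) ^+ (Num.truncn (p + 1)).+1)); last first.
      by apply: polygrowthX; apply: polygrowthD => //; exact: polygrowth_cst.
    move=> y; rewrite !ger0_norm ?powR_ge0 ?exprn_ge0 ?addr_ge0 //.
    have u1 : 1 <= 1 + u y by rewrite lerDl.
    apply: (@le_trans _ _ ((1 + u y) `^ (p + 1))).
      by apply: ge0_ler_powR; rewrite ?nnegrE ?addr_ge0 // ?lerDr // ltW.
    rewrite -powR_mulrn ?addr_ge0 //; apply: ler_powR => //.
    by apply/ltW/truncnS_gt.
  apply: polygrowthD; first apply: polygrowthB; first apply: polygrowthB.
  - by apply: polygrowthM => //; apply: polygrowth_sum => k; apply: polygrowthM.
  - apply: polygrowthM => //; apply: polygrowthM; first exact: polygrowth_cst.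
    by apply: polygrowth_sum => k; apply: polygrowthX.
  - apply: polygrowthM => //; apply: polygrowthB; apply: polygrowthM => //; try exact: polygrowth_cst.
    exact: polygrowthX.
  - apply: polygrowthM; first exact: polygrowth_cst.
    apply: polygrowthD; apply: polygrowthM => //; last first.
    + by apply: polygrowthM; [exact: polygrowth_cst|exact: polygrowthX].
    + exact: polygrowthM.
    + by apply: polygrowthB; [exact: polygrowth_cst|apply: polygrowthM => //; exact: polygrowth_cst].
have gV i : exists K, forall y, `|rho y * pohozaev_field i y| * `|y| ^+ n <= K.
  have [|K HK] := @gaussian_polygrowth_bounded R n (fun y => pohozaev_field i y * `|y| ^+ n).
    by apply: polygrowthM => //; apply: polygrowthX; exact: polygrowth_norm.
  exists K => y; apply: le_trans (HK y); rewrite mulrA [leRHS]normrM.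
  by rewrite [X in _ <= _ * X]ger0_norm ?exprn_ge0.
have [K HK] : exists K, forall i y, `|rho y * pohozaev_field i y| * `|y| ^+ n <= K.
  have [Kf HKf] := choice gV.
  exists (\sum_i Kf i) => i y; apply: le_trans (HKf i y) _.
  rewrite (bigD1 i) //= lerDl; apply: sumr_ge0 => j _.
  by apply: le_trans (HKf j 0); rewrite mulr_ge0 ?exprn_ge0.
have sumE y : \sum_i (- 2^-1 * y 0 i * rho y * pohozaev_field i y + rho y * dpohozaev_field i y)
   = rho y * (sqgrad y * (1 - n%:R / 2 + n%:R * q + sqnorm y * (4^-1 - q / 2))).
  rewrite -pohozaev_identity mulr_sumr; apply: eq_bigr => i _; ring.
have := @divergence_ge0_eq0 R n (fun i y => rho y * pohozaev_field i y)
  (fun i y => - 2^-1 * y 0 i * rho y * pohozaev_field i y + rho y * dpohozaev_field i y) K n0.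
move=> H; have {}H := H _ _ HK _ x; move: H; rewrite sumE.
move=> H; have : rho x * (sqgrad x * (1 - n%:R / 2 + n%:R * q + sqnorm x * (4^-1 - q / 2))) = 0.
  apply: H.
  - by move=> i y; apply: is_deriveMf; exact: is_derive_pohozaev_field.
  - move=> i y.
    have cV := @cts_pohozaev_field i y.
    apply: ctsD; apply: ctsM => //; last exact: cts_dpohozaev_field.
    apply: ctsM => //; apply: ctsM; [exact: cts_cst|exact: cts_coord].
  - by move=> y; rewrite sumE !mulr_ge0 ?expR_ge0 // ltW.
move=> /eqP; rewrite !mulf_eq0 [rho x == 0]gt_eqF ?expR_gt0 //= [X in _ || X]gt_eqF ?AB //.
by rewrite orbF => /eqP.
Qed.
End Profile.

(** * The exponents of the Bernstein function *)

Section Exponents.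
Context {R : realType}.
Implicit Types (p N a b c l : R).

(** The three last conditions say that the quadratic form in [X = |grad u|^2 /
    v^2] and [Y = v^(p-1)] that governs the Bernstein function [v^(-a) |grad
    u|^2 + c v^(p+1-a)] has positive coefficients; [l] is the coefficient of the
    rank-one part of the matrix against which the Hessian is tested. *)
Definition good_exponents N p a c l : Prop :=
  let b := p + 1 - a in
  [/\ 2 <= a, 0 < b, 0 < c, 0 <= l &
   [/\ 0 < 2 * l * a - 2 * l ^+ 2 + 2 / N * l ^+ 2 - a * (a - 1),
     0 < - 2 * l * c * b + 4 * l / N - 2 * p + a - c * a * (a - 1) + c * p * (p + 1)
   & 0 < 2 / N - c * b]].

(** As [c b] tends to its upper limit [2 / N], the coefficient of [X Y] tends to
    [(a (N + 2) - 2 p (N - 1)) / N], in which [l] no longer appears. It is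
    affine in [c b], so a value slightly below [2 / N] will do. *)
Lemma good_exponents_of N p a l : 0 < N -> 2 <= a -> a < p + 1 -> 0 <= l ->
  0 < 2 * l * a - 2 * l ^+ 2 + 2 / N * l ^+ 2 - a * (a - 1) ->
  2 * p * (N - 1) < a * (N + 2) ->
  exists c, good_exponents N p a c l.
Proof.
move=> N0 a2 ap l0 al ka.
pose b := p + 1 - a; have b0 : 0 < b by rewrite subr_gt0.
pose d := a - 2 * l + p.
pose K := (a * (N + 2) - 2 * p * (N - 1)) / N.
have K0 : 0 < K by rewrite divr_gt0 // subr_gt0.
have d1 : 0 < 2 * (`|d| + 1) by rewrite mulr_gt0 // ltr_wpDl.
pose e := Num.min N^-1 (K / (2 * (`|d| + 1))).
have e0 : 0 < e by rewrite lt_min invr_gt0 N0 divr_gt0.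
have eN : e <= N^-1 by rewrite ge_min lexx.
have eK : e * (2 * (`|d| + 1)) <= K.
  by rewrite -ler_pdivlMr // ge_min lexx orbT.
have N'0 : 0 < N^-1 by rewrite invr_gt0.
pose t := 2 * N^-1 - e; have t0 : 0 < t by rewrite /t; lra.
exists (t / b); rewrite /good_exponents -/b.
have tb : t / b * b = t by rewrite divfK // gt_eqF.
split=> //; first exact: divr_gt0.
split=> //; last by rewrite tb /t; lra.
have -> : - 2 * l * (t / b) * b + 4 * l / N - 2 * p + a - t / b * a * (a - 1)
    + t / b * p * (p + 1) = K - e * d.
  have pE : p = a + b - 1 by rewrite /b; ring.
  rewrite /t /K /d pE; field.
  by rewrite !gt_eqF.
have : e * d <= e * `|d| by rewrite ler_pM2l // ler_norm.
have : 0 <= `|d| by [].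
move=> d00; have : 0 <= e * `|d| by rewrite mulr_ge0 // ltW.
lra.
Qed.

(** For [N >= 3] the best [l] for the coefficient of [X^2] is [a N / (2 (N -
    1))], and the main conditions become [2 p (N - 1) / (N + 2) < a < 2 (N - 1)
    / (N - 2)]; this interval is nonempty exactly when [p < (N + 2) / (N - 2)].
    For [N <= 2] there is no upper bound besides [p + 1] and [l = a] suffices.
    *)
Lemma exist_good_exponents (n : nat) p : (1 <= n)%N -> 1 < p ->
  (p%:E < p_star R n)%E ->
  exists a c l, good_exponents n%:R p a c l.
Proof.
move=> n1 p1; rewrite /p_star; set N : R := n%:R.
have N1 : 1 <= N by rewrite ler1n.
have A1 : 2 * p * (N - 1) < (p + 1) * (N + 2) -> 2 * p * (N - 1) / (N + 2) < p + 1.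
  by rewrite ltr_pdivrMr // ltr_wpDl // (le_trans ler01).
have N2 : 0 < N + 2 by rewrite ltr_wpDl // (le_trans ler01).
case: leqP => [n2 _|n3 pp].
  have N2' : N <= 2 by rewrite /N ler_nat.
  pose m := Num.max 2 (2 * p * (N - 1) / (N + 2)).
  have mp : m < p + 1.
    rewrite gt_max; apply/andP; split; first by lra.
    apply: A1; nra.
  pose a := (m + (p + 1)) / 2.
  have ma : m < a by rewrite /a; lra.
  have a2 : 2 < a by apply: le_lt_trans ma; rewrite le_max lexx.
  have aA : 2 * p * (N - 1) < a * (N + 2).
    by rewrite -ltr_pdivrMr //; apply: le_lt_trans ma; rewrite le_max lexx orbT.
  exists a; suff [c H] : exists c, good_exponents N p a c a by exists c, a.
  apply: good_exponents_of => //; rewrite ?ltW //; try lra.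
    by rewrite /a; lra.
  have : 1 <= 2 / N by rewrite ler_pdivlMr ?mul1r //; lra.
  have : 0 < a ^+ 2 by rewrite exprn_gt0; lra.
  move=> ? ?; have : a ^+ 2 <= 2 / N * a ^+ 2 by rewrite ler_peMl // ltW.
  nra.
have N3 : 3 <= N by rewrite /N ler_nat.
have {}pp : p * (N - 2) < N + 2.
  by move: pp; rewrite lte_fin ltr_pdivlMr // /N; lra.
(* The upper bound [p + 1] keeps the exponent [b = p + 1 - a] positive. *)
pose U := Num.min (p + 1) (2 * (N - 1) / (N - 2)).
pose m := Num.max 2 (2 * p * (N - 1) / (N + 2)).
have mU : m < U.
  rewrite gt_max !lt_min; apply/andP; split; apply/andP; split.
  - by lra.
  - by rewrite ltr_pdivlMr; lra.
  - apply: A1; nra.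
  rewrite ltr_pdivrMr // [ltRHS]mulrAC ltr_pdivlMr; last by lra.
  nra.
pose a := (m + U) / 2.
have ma : m < a by rewrite /a; lra.
have aU : a < U by rewrite /a; lra.
move: (aU); rewrite lt_min => /andP[ap aN].
have a2 : 2 < a by apply: le_lt_trans ma; rewrite le_max lexx.
have aA : 2 * p * (N - 1) < a * (N + 2).
  by rewrite -ltr_pdivrMr //; apply: le_lt_trans ma; rewrite le_max lexx orbT.
move: aN; rewrite ltr_pdivlMr; last by lra.
move=> aN.
pose l := a * N / (2 * (N - 1)).
have d0 : 0 < 2 * (N - 1) by lra.
exists a; suff [c H] : exists c, good_exponents N p a c l by exists c, l.
apply: good_exponents_of => //; rewrite ?ltW //; try lra.
  by rewrite divr_gt0 // mulr_gt0; lra.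
have -> : 2 * l * a - 2 * l ^+ 2 + 2 / N * l ^+ 2 - a * (a - 1)
   = a * (2 * (N - 1) - a * (N - 2)) / (2 * (N - 1)).
  rewrite /l; field.
  by apply/andP; split; rewrite gt_eqF //; lra.
by rewrite divr_gt0 // mulr_gt0 //; lra.
Qed.
End Exponents.

(** * Absorbing the lower-order terms *)

Section Algebra.
Context {R : realType}.

(** For large [v] the quotient [(v - 1) / v] is at least [(1 - d)^(1/p)]; on the
    remaining bounded range everything is bounded. *)
Lemma reaction_lower (p b d : R) : 1 < p -> 0 <= b -> 0 < d < 1 ->
  exists2 C : R, 0 <= C & forall v, 1 <= v ->
    (1 - d) * v `^ (p - 1) - C <= ((v - 1) `^ p - b * (v - 1)) / v.
Proof.
move=> p1 b0 /andP[d0 d1]; have p0 : 0 < p by exact: lt_trans p1.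
pose th := (1 - d) `^ p^-1.
have th0 : 0 <= th by exact: powR_ge0.
have thp : th `^ p = 1 - d by rewrite -powRrM mulVf ?gt_eqF // powRr1 //; lra.
have th1 : th < 1.
  rewrite ltNge; apply/negP => th1.
  have : 1 `^ p <= th `^ p by apply: ge0_ler_powR; rewrite ?nnegrE // ltW.
  by rewrite powR1 thp; lra.
(* For [v >= v0] one has [v - 1 >= th * v]. *)
pose v0 := (1 - th)^-1.
exists (b + v0 `^ (p - 1)); first by rewrite addr_ge0 // powR_ge0.
move=> v v1; have v00 : 0 < v by lra.
have H1 : 0 <= (v - 1) `^ p by exact: powR_ge0.
have H2 : b * (v - 1) <= b * v by rewrite ler_wpM2l //; lra.
have H3 : 0 <= v0 `^ (p - 1) by exact: powR_ge0.
rewrite ler_pdivlMr // mulrBl mulrDl.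
have [vv0|vv0] := lerP v0 v; last first.
  have : (1 - d) * v `^ (p - 1) <= v0 `^ (p - 1).
    apply: (@le_trans _ _ (v `^ (p - 1))).
      by rewrite ler_piMl ?powR_ge0 //; lra.
    apply: ge0_ler_powR; rewrite ?nnegrE; lra.
  move=> H; have : (1 - d) * v `^ (p - 1) * v <= v0 `^ (p - 1) * v by rewrite ler_pM2r.
  lra.
have : (th * v) `^ p <= (v - 1) `^ p.
  have : 1 <= (1 - th) * v by rewrite -ler_pdivrMl ?subr_gt0 // mulr1.
  move=> H; have tv : 0 <= th * v by rewrite mulr_ge0 // ltW.
  apply: ge0_ler_powR; rewrite ?nnegrE //; lra.
rewrite powRM ?(ltW v00) // thp -(@mulr_powRB1 _ v p (ltW v00) p0).
have : 0 <= v0 `^ (p - 1) * v by rewrite mulr_ge0 // ltW.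
lra.
Qed.

(** The quadratic part of the hypothesis is at least [mu (x + Y)^2]. All error
    terms are at most [x + Y] times a small multiple of [x + Y], a constant, [r
    sqrt (x + Y)] (drift), [r sqrt (x + Y) / s], [1 / s] or [r^2 / s^2]
    (cutoff). After division by [x + Y] and multiplication by [s^2 <= r^4] this
    is a quadratic inequality for [s sqrt (x + Y)] with coefficients that are
    powers of [r]. *)
Lemma bernstein_algebra (N p a c l : R) : 0 < N -> good_exponents N p a c l ->
  exists2 d : R, 0 < d < 1 & forall C, 0 <= C ->
  exists2 C0 : R, 0 <= C0 & forall r s q x Y xi m : R,
    1 <= r -> 0 < s -> s <= r ^+ 2 -> q <= r ^+ 2 -> 0 <= q ->
    0 <= x -> 0 <= Y -> xi ^+ 2 <= q * x ->
    (1 - d) * Y - C <= m -> m <= Y ->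
    2 * (l * ((x + c * Y) * (a * x + 4 * xi / s) - c * (p + 1) * Y * x)
         - l ^+ 2 * x ^+ 2 + (m + l * x - 2^-1 * xi) ^+ 2 / N) - 2 * p * Y * x
    <= (x + c * Y) * (a * (a - 1) * x - a * m + 8 * a * xi / s + 4 * N / s
           + 24 * q / s ^+ 2) + c * (p + 1) * (Y * m - p * Y * x) ->
    s ^+ 2 * (x + Y) <= C0 * r ^+ 6.
Proof.
move=> N0; rewrite /good_exponents; set b := p + 1 - a.
set al := (X in [/\ 0 < X, _ & _]); set ka := (X in [/\ _, 0 < X & _]).
set om := (X in [/\ _, _ & 0 < X]).
move=> [a2 b0 c0 l0 [al0 ka0 om0]].
pose mu := Num.min al (Num.min (ka / 2) om).
have mu0 : 0 < mu by rewrite !lt_min al0 om0 divr_gt0.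
have mal : mu <= al by rewrite ge_min lexx.
have mka : mu <= ka / 2 by rewrite !ge_min lexx orbT.
have mom : mu <= om by rewrite !ge_min lexx !orbT.
have N'0 : 0 < N^-1 by rewrite invr_gt0.
pose M1 := a + 4 * N^-1 * (1 + l).
have M10 : 0 < M1.
  have : 0 <= N^-1 * (1 + l) by rewrite mulr_ge0 //; lra.
  rewrite /M1; lra.
(* [d] is the loss allowed in [m >= (1 - d) * Y - C]: the error [M1 * d * S] must
   be absorbed by half of the quadratic form. *)
pose d := Num.min 2^-1 (mu / (2 * M1)).
have d0 : 0 < d by rewrite lt_min invr_gt0 ltr0n /= divr_gt0 ?mulr_gt0.
have d1 : d <= 2^-1 by rewrite ge_min lexx.
have dM : M1 * d <= mu / 2.
  have : d <= mu / (2 * M1) by rewrite ge_min lexx orbT.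
  by rewrite ler_pdivlMr ?mulr_gt0 //; lra.
exists d; first by rewrite d0; lra.
move=> C C00.
pose M2 := 2 * N^-1 * (1 + l).
pose M3 := 8 * `|a - l| * (1 + c).
have M20 : 0 <= M2 by rewrite !mulr_ge0 // ?ltW //; lra.
have M30 : 0 <= M3 by rewrite !mulr_ge0 // ?ltW //; lra.
pose D := M1 * C + (1 + c) * (4 * N + 24).
have D0 : 0 <= D.
  by rewrite addr_ge0 // mulr_ge0 // ?ltW //; lra.
pose E := M2 + M3.
have E0 : 0 <= E by rewrite addr_ge0.
have W0 : 0 <= 4 / mu * (D + E ^+ 2 / mu).
  apply: mulr_ge0; first by apply: divr_ge0 => //; exact: ltW.
  by apply: addr_ge0 => //; apply: divr_ge0; [exact: sqr_ge0|exact: ltW].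
exists (4 / mu * (D + E ^+ 2 / mu)) => //.
move=> r s q x Y xi m r1 s0 sr qr q0 x0 Y0 xiq mlow mY.
pose S := x + Y; have S0 : 0 <= S by rewrite addr_ge0.
pose t := Num.sqrt S; have t0 : 0 <= t by exact: sqrtr_ge0.
have tt : t ^+ 2 = S by exact: sqr_sqrtr.
have r0 : 0 < r by lra.
have xir : `|xi| <= r * t.
  have rt0 : 0 <= r * t by rewrite mulr_ge0 // ltW.
  rewrite -ler_sqr ?nnegrE // real_normK ?num_real //.
  apply: le_trans xiq _; rewrite exprMn tt ler_pM //.
  by rewrite lerDl.
pose si := s^-1; have si0 : 0 < si by rewrite invr_gt0.
have ssi : s * si = 1 by rewrite mulfV // gt_eqF.
pose g := Y - m; have g0 : 0 <= g by rewrite subr_ge0.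
have gS : g <= d * S + C.
  have : d * Y <= d * S by rewrite ler_pM2l // lerDr.
  rewrite /g; lra.
pose w := Y + l * x; pose e := g + 2^-1 * xi.
have w0 : 0 <= w by rewrite addr_ge0 // mulr_ge0.
have wS : w <= (1 + l) * S.
  have : 0 <= l * Y by rewrite mulr_ge0.
  rewrite /w /S; lra.
pose Z := x + c * Y.
have Z0 : 0 <= Z by rewrite addr_ge0 // mulr_ge0 // ltW.
have ZS : Z <= (1 + c) * S.
  have : 0 <= c * x by rewrite mulr_ge0 // ltW.
  rewrite /Z /S; lra.
move=> main.
have step1 : al * x ^+ 2 + ka * (x * Y) + om * Y ^+ 2 <=
    a * x * g - c * b * (Y * g) + 4 * N^-1 * (w * e) - 2 * N^-1 * e ^+ 2
    + 8 * (a - l) * (Z * xi) * si + Z * (4 * N * si + 24 * q * si ^+ 2).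
  rewrite -subr_ge0; rewrite -subr_ge0 in main; apply: (le_trans main).
  rewrite le_eqVlt; apply/orP; left; apply/eqP.
  rewrite /al /ka /om /b /Z /w /e /g /si exprVn; ring.
clear main.
have step2 : mu * S ^+ 2 <= al * x ^+ 2 + ka * (x * Y) + om * Y ^+ 2.
  have h1 : mu * x ^+ 2 <= al * x ^+ 2 by rewrite ler_wpM2r // sqr_ge0.
  have h2 : mu * (x * Y) <= ka / 2 * (x * Y) by rewrite ler_wpM2r // mulr_ge0.
  have h3 : mu * Y ^+ 2 <= om * Y ^+ 2 by rewrite ler_wpM2r // sqr_ge0.
  have -> : S ^+ 2 = x ^+ 2 + 2 * (x * Y) + Y ^+ 2 by rewrite /S; ring.
  lra.
have k1 : a * x * g <= a * S * (d * S + C).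
  have a0 : 0 <= a by lra.
  apply: ler_pM => //; first by rewrite mulr_ge0.
  by rewrite ler_wpM2l // lerDl.
have k2 : 0 <= c * b * (Y * g) by rewrite !mulr_ge0 // ltW.
have k3 : w * e <= (1 + l) * S * (d * S + C + 2^-1 * (r * t)).
  apply: (@le_trans _ _ (w * (d * S + C + 2^-1 * (r * t)))).
    rewrite ler_wpM2l // /e; have := ler_norm xi; lra.
  rewrite ler_wpM2r //; have : 0 <= r * t by rewrite mulr_ge0 // ltW.
  lra.
have k4 : 0 <= N^-1 * e ^+ 2 by rewrite mulr_ge0 ?sqr_ge0 // ltW.
have k5 : (a - l) * (Z * xi) <= `|a - l| * ((1 + c) * S * (r * t)).
  apply: le_trans (ler_norm _) _; rewrite normrM ler_wpM2l // normrM ger0_norm //.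
  by apply: ler_pM.
have k6 : Z * (4 * N * si + 24 * q * si ^+ 2) <=
    (1 + c) * S * (4 * N * si + 24 * r ^+ 2 * si ^+ 2).
  have q1 : q * si ^+ 2 <= r ^+ 2 * si ^+ 2 by rewrite ler_wpM2r // sqr_ge0.
  have q2 : 0 <= q * si ^+ 2 by rewrite mulr_ge0 // sqr_ge0.
  have q3 : 0 <= N * si by rewrite mulr_ge0 // ltW.
  apply: ler_pM => //; lra.
have k3' : N^-1 * (w * e) <= N^-1 * ((1 + l) * S * (d * S + C + 2^-1 * (r * t))).
  by rewrite ler_pM2l.
have k5' : (a - l) * (Z * xi) * si <= `|a - l| * ((1 + c) * S * (r * t)) * si.
  by rewrite ler_pM2r.
have step3 : S * (mu * S) <= S * (M1 * (d * S + C) + M2 * (r * t) + M3 * (r * t) * si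
   + (1 + c) * (4 * N * si + 24 * r ^+ 2 * si ^+ 2)).
  apply: le_trans (_ : mu * S ^+ 2 <= _); first by rewrite expr2 mulrCA.
  apply: le_trans step2 _; apply: le_trans step1 _.
  rewrite /M1 /M2 /M3.
  apply: le_trans (_ : a * S * (d * S + C) +
     4 * (N^-1 * ((1 + l) * S * (d * S + C + 2^-1 * (r * t))))
     + 8 * (`|a - l| * ((1 + c) * S * (r * t)) * si)
     + (1 + c) * S * (4 * N * si + 24 * r ^+ 2 * si ^+ 2) <= _).
    lra.
  by rewrite le_eqVlt; apply/orP; left; apply/eqP; move: (`|a - l|) => D1; field; rewrite gt_eqF.
clear step1 step2 k1 k2 k3 k4 k5 k6 k3' k5'.
have [S00|Sp] := eqVneq S 0.
  by rewrite -/S S00 mulr0 mulr_ge0 ?exprn_ge0 ?(ltW r0).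
have {}Sp : 0 < S by rewrite lt_neqAle eq_sym Sp.
move: step3; rewrite ler_pM2l // => step3.
have step4 : mu / 2 * S <= M1 * C + M2 * (r * t) + M3 * (r * t) * si
   + (1 + c) * (4 * N * si + 24 * r ^+ 2 * si ^+ 2).
  have : M1 * d * S <= mu / 2 * S by rewrite ler_wpM2r.
  lra.
clear step3 gS wS ZS.
pose th := s * t; have th0 : 0 <= th by rewrite mulr_ge0 // ltW.
have thS : th ^+ 2 = s ^+ 2 * S by rewrite exprMn tt.
have step5 : mu / 2 * th ^+ 2 <= M1 * C * s ^+ 2 + M2 * (s * r * th) + M3 * (r * th)
   + (1 + c) * (4 * N * s + 24 * r ^+ 2).
  have s20 : 0 <= s ^+ 2 by rewrite sqr_ge0.
  have := ler_wpM2l s20 step4; rewrite thS.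
  have -> : s ^+ 2 * (M1 * C + M2 * (r * t) + M3 * (r * t) * si
   + (1 + c) * (4 * N * si + 24 * r ^+ 2 * si ^+ 2)) =
   M1 * C * s ^+ 2 + M2 * (s * r * (s * t)) + M3 * (r * (s * t)) * (s * si)
   + (1 + c) * (4 * N * s * (s * si) + 24 * r ^+ 2 * (s * si) ^+ 2) by ring.
  rewrite ssi expr1n !mulr1 => H; apply: le_trans H.
  rewrite le_eqVlt; apply/orP; left; apply/eqP; ring.
clear step4.
pose Q := r ^+ 3; have Q0 : 0 < Q by rewrite exprn_gt0.
have r2 : 1 <= r ^+ 2 by rewrite exprn_ege1.
have r4 : 1 <= r ^+ 4 by rewrite exprn_ege1.
have r26 : r ^+ 2 <= r ^+ 6 by rewrite ler_weXn2l.
have s26 : s ^+ 2 <= r ^+ 6.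
  apply: (@le_trans _ _ (r ^+ 4)); last by rewrite ler_weXn2l.
  have -> : r ^+ 4 = (r ^+ 2) ^+ 2 by rewrite -exprM.
  by rewrite ler_sqr ?nnegrE ?sqr_ge0 ?(ltW s0).
have sr3 : s * r <= Q by rewrite /Q exprSr ler_pM2r.
have rr3 : r <= Q by rewrite /Q -[leLHS]expr1 ler_weXn2l.
have QE : r ^+ 6 = Q ^+ 2 by rewrite /Q -exprM.
have step6 : mu / 2 * th ^+ 2 <= D * Q ^+ 2 + E * (Q * th).
  rewrite -QE; apply: le_trans step5 _.
  have j1 : M1 * C * s ^+ 2 <= M1 * C * r ^+ 6 by rewrite ler_wpM2l // mulr_ge0 // ltW.
  have j2 : M2 * (s * r * th) <= M2 * (Q * th) by rewrite ler_wpM2l // ler_wpM2r.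
  have j3 : M3 * (r * th) <= M3 * (Q * th) by rewrite ler_wpM2l // ler_wpM2r.
  have j4 : (1 + c) * (4 * N * s + 24 * r ^+ 2) <= (1 + c) * ((4 * N + 24) * r ^+ 6).
    rewrite ler_wpM2l //; first by lra.
    have : N * s <= N * r ^+ 6 by rewrite ler_pM2l // (le_trans sr).
    lra.
  rewrite /D /E; lra.
clear step5.
(* Young's inequality, by completing the square. *)
have step7 : E * (Q * th) <= mu / 4 * th ^+ 2 + E ^+ 2 / mu * Q ^+ 2.
  have : 0 <= mu / 4 * (th - 2 / mu * (E * Q)) ^+ 2.
    by rewrite mulr_ge0 ?sqr_ge0 // divr_ge0 // ltW.
  have -> : mu / 4 * (th - 2 / mu * (E * Q)) ^+ 2 =
     mu / 4 * th ^+ 2 + E ^+ 2 / mu * Q ^+ 2 - E * (Q * th).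
    by field; rewrite gt_eqF.
  lra.
rewrite -/S -thS QE.
have -> : 4 / mu * (D + E ^+ 2 / mu) * Q ^+ 2 = (D * Q ^+ 2 + E ^+ 2 / mu * Q ^+ 2) / (mu / 4).
  by field; rewrite gt_eqF.
rewrite ler_pdivlMr ?divr_gt0 //; lra.
Qed.
End Algebra.

(** * The pointwise inequality at the touching point *)

Section Combine.
Context {R : realType}.
(** The quadratic inequality in homogeneous variables, obtained from the
    ordering of the Laplacians by eliminating [Hvv], the Hessian in the gradient
    direction, and [Qs], the Hessian paired with [x] and the gradient, by means
    of the equality of the gradients. The drift contributions of Bochner's
    formula and of the barrier cancel; terms of favourable sign are dropped. *)
Lemma touching_algebra (N p a c l beta v s G X L Hvv Qs H2 M Y U N0 x xi m : R) :
  0 < N -> 1 <= v -> 0 < s -> 0 <= c -> 1 < p -> 0 <= G -> 0 <= M -> U <= Y ->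
  0 <= beta -> 0 <= Y ->
  L = 2^-1 * X - N0 ->
  let T := G + c * (v ^+ 2 * Y) in
  2 * Hvv = T * (a * G / v + 4 * X / s) - c * (p + 1) * (v * Y) * G ->
  2 * Qs = T * (a * X / v + 4 * M / s) - c * (p + 1) * (v * Y) * X ->
  2 * (l / v) * Hvv - (l / v) ^+ 2 * G ^+ 2 + (L - l / v * G) ^+ 2 / N <= H2 ->
  2 * H2 + (G + Qs - 2 * (p * U - beta) * G) <=
    T * (a * (a - 1) * G / v ^+ 2 + a * L / v + 8 * a * X / (s * v) + 4 * N / s
         + 24 * M / s ^+ 2) - c * (p + 1) * (p * Y * G + v * Y * L) ->
  x = G / v ^+ 2 -> xi = X / v -> m = N0 / v ->
  2 * (l * ((x + c * Y) * (a * x + 4 * xi / s) - c * (p + 1) * Y * x)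
         - l ^+ 2 * x ^+ 2 + (m + l * x - 2^-1 * xi) ^+ 2 / N) - 2 * p * Y * x
    <= (x + c * Y) * (a * (a - 1) * x - a * m + 8 * a * xi / s + 4 * N / s
           + 24 * M / s ^+ 2) + c * (p + 1) * (Y * m - p * Y * x).
Proof.
move=> N0' v1 s0 c0 p1 G0 M0 UY b0 Y0 LE T HH QQ HL main xE xiE mE.
have v0 : 0 < v by lra.
have T0 : 0 <= T by rewrite addr_ge0 // mulr_ge0 // mulr_ge0 // exprn_ge0 // ltW.
rewrite -subr_ge0 in main; rewrite -subr_ge0 in HL; rewrite -subr_ge0.
set D := (X in 0 <= X) in main; set E := (X in 0 <= X) in HL.
have F0 : 0 <= G + 2 * beta * G + 2 * (T * M / s) + 2 * p * ((Y - U) * G).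
  have e1 : 0 <= beta * G by rewrite mulr_ge0.
  have e2 : 0 <= T * M / s by rewrite divr_ge0 ?mulr_ge0 // ltW.
  have e3 : 0 <= p * ((Y - U) * G).
    by rewrite !mulr_ge0 ?subr_ge0 // (le_trans ler01) // ltW.
  lra.
have -> : (x + c * Y) * (a * (a - 1) * x - a * m + 8 * a * xi / s + 4 * N / s
           + 24 * M / s ^+ 2) + c * (p + 1) * (Y * m - p * Y * x) -
  (2 * (l * ((x + c * Y) * (a * x + 4 * xi / s) - c * (p + 1) * Y * x)
         - l ^+ 2 * x ^+ 2 + (m + l * x - 2^-1 * xi) ^+ 2 / N) - 2 * p * Y * x)
  = (D + 2 * E + (G + 2 * beta * G + 2 * (T * M / s) + 2 * p * ((Y - U) * G))) / v ^+ 2.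
  have HE : Hvv = (T * (a * G / v + 4 * X / s) - c * (p + 1) * (v * Y) * G) / 2.
    by rewrite -HH; field.
  have QE : Qs = (T * (a * X / v + 4 * M / s) - c * (p + 1) * (v * Y) * X) / 2.
    by rewrite -QQ; field.
  rewrite /D /E HE QE LE /T xE xiE mE; field.
  by rewrite !gt_eqF.
apply: divr_ge0; last exact: sqr_ge0.
by apply: addr_ge0 => //; apply: addr_ge0 => //; apply: mulr_ge0.
Qed.
End Combine.

Section LinearAlgebra.
Context {R : realType} {n : nat}.

(** Expand the nonnegative sum of the squares of [F g_i - X f_i], where [F] is
    the sum of the squares of the [f_i] and [X] the scalar product. *)
Lemma cauchy_schwarz (f g : 'I_n -> R) :
  (\sum_i f i * g i) ^+ 2 <= (\sum_i f i ^+ 2) * (\sum_i g i ^+ 2).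
Proof.
set X := \sum_i f i * g i; set F := \sum_i f i ^+ 2; set G := \sum_i g i ^+ 2.
have F0 : 0 <= F by apply: sumr_ge0 => i _; exact: sqr_ge0.
have [FE|Fn] := eqVneq F 0.
  have f0 i : f i = 0.
    have := psumr_eq0P (fun i _ => sqr_ge0 (f i)) FE.
    by move=> /(_ i isT)/eqP; rewrite sqrf_eq0 => /eqP.
  rewrite FE mul0r /X big1 ?expr0n //.
  by move=> i _; rewrite f0 mul0r.
have Fp : 0 < F by rewrite lt_neqAle eq_sym Fn.
have : 0 <= \sum_i (F * g i - X * f i) ^+ 2.
  by apply: sumr_ge0 => i _; exact: sqr_ge0.
have -> : \sum_i (F * g i - X * f i) ^+ 2 = F * (F * G - X ^+ 2).
  have -> : \sum_i (F * g i - X * f i) ^+ 2 =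
      \sum_i (F ^+ 2 * g i ^+ 2 + (- 2 * F * X) * (f i * g i) + X ^+ 2 * f i ^+ 2).
    by apply: eq_bigr => i _; ring.
  rewrite !big_split /= -!mulr_sumr -/X -/F -/G; ring.
by rewrite pmulr_rge0 // subr_ge0.
Qed.

(** The sum of the squares of the entries of [h - k g (x) g - m Id] is
    nonnegative; the value of [m] is the optimal one. Testing against this
    matrix rather than splitting along the direction of [g] avoids a separate
    treatment of critical points. *)
Lemma hessian_lower (h : 'I_n -> 'I_n -> R) (g : 'I_n -> R) (k : R) :
  (0 < n)%N ->
  2 * k * (\sum_j \sum_i g j * (g i * h i j)) - k ^+ 2 * (\sum_i g i ^+ 2) ^+ 2
   + (\sum_i h i i - k * (\sum_i g i ^+ 2)) ^+ 2 / n%:R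
  <= \sum_j \sum_i h i j ^+ 2.
Proof.
move=> n0; have N0 : n%:R != 0 :> R by rewrite pnatr_eq0 -lt0n.
set H := \sum_j _; set G := \sum_i _ ^+ 2; set L := \sum_i h i i.
pose m := (L - k * G) / n%:R.
have : 0 <= \sum_j \sum_i (h i j - k * (g i * g j) - m * (i == j)%:R) ^+ 2.
  by apply: sumr_ge0 => j _; apply: sumr_ge0 => i _; exact: sqr_ge0.
have -> : \sum_j \sum_i (h i j - k * (g i * g j) - m * (i == j)%:R) ^+ 2
  = \sum_j \sum_i (h i j ^+ 2 + k ^+ 2 * (g j ^+ 2 * g i ^+ 2)
     - 2 * k * (g j * (g i * h i j)) + (i == j)%:R * (m ^+ 2 - 2 * m * h i j
     + 2 * m * k * (g i * g j))).
  apply: eq_bigr => j _; apply: eq_bigr => i _.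
  by case: eqVneq => _; rewrite /=; ring.
have dg (F : 'I_n -> 'I_n -> R) : \sum_j \sum_i (i == j)%:R * F i j = \sum_j F j j.
  apply: eq_bigr => j _; rewrite (bigD1 j) //= eqxx mul1r big1 ?addr0 //.
  by move=> i /negbTE ->; rewrite mul0r.
under eq_bigr do rewrite !big_split /=.
rewrite !big_split /= dg !big_split /= sumr_const card_ord.
have -> : \sum_j \sum_i k ^+ 2 * (g j ^+ 2 * g i ^+ 2) = k ^+ 2 * G ^+ 2.
  under eq_bigr do rewrite -!mulr_sumr.
  by rewrite -mulr_sumr -mulr_suml -expr2.
have -> : \sum_j \sum_i - (2 * k * (g j * (g i * h i j))) = - (2 * k * H).
  rewrite /H mulr_sumr -sumrN; apply: eq_bigr => j _.
  by rewrite mulr_sumr -sumrN.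
have -> : \sum_j - (2 * m * h j j) = - (2 * m * L) by rewrite sumrN -mulr_sumr.
have -> : \sum_j 2 * m * k * (g j * g j) = 2 * m * k * G by rewrite -mulr_sumr.
move=> S0; rewrite -subr_ge0; apply: (le_trans S0).
rewrite le_eqVlt; apply/orP; left; apply/eqP.
by rewrite -mulr_natr /m; field.
Qed.
End LinearAlgebra.

(** * The barrier touching the gradient *)

Section Touching.
Context {R : realType} {n : nat}.
Local Notation V := 'rV[R]_n.
Implicit Types (x y v w : V) (t h : R).

Lemma is_deriveVf (f : V -> R) x v a : f x != 0 -> is_derive x v f a ->
  is_derive x v (fun y => (f y)^-1) (- (f x) ^- 2 * a).
Proof.
move=> f0 [df <-]; apply: DeriveDef; first exact: derivableV.
by rewrite deriveV.
Qed.

Context (p : R) (u : V -> R).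
Hypotheses (p1 : 1 < p) (u0 : forall x, 0 <= u x).
Hypothesis sol : classical_solution p (1 / (p - 1)) u.
Local Notation beta := (1 / (p - 1)).
Let uC2 : C2 u. Proof. by case: sol. Qed.
Let p0 : 0 < p. Proof. exact: lt_trans p1. Qed.

(** The derivative of the Laplacian, computed from the equation: this is the
    only access to third derivatives of [u]. *)
Definition dlaplacian i x := 2^-1 * (partial i u x + \sum_k x 0 k * partial i (partial k u) x)
   - p * `|u x| `^ (p - 1) * partial i u x + beta * partial i u x.

Lemma is_derive_laplacian x i :
  is_derive x 'e_i (fun z => \sum_j partial j (partial j u) z) (dlaplacian i x).
Proof.
have -> : (fun z => \sum_j partial j (partial j u) z)
  = (fun z => 2^-1 * radial_deriv u z - `|u z| `^ p + beta * u z).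
  by apply/funext => z; rewrite -(laplacianE p1 u0 sol).
apply: is_deriveDf; last by apply: is_deriveZf; exact: C2_is_derive.
apply: is_deriveBf; first by apply: is_deriveZf; exact: (is_derive_radial_deriv sol).
exact: (is_derive_upow u0 sol).
Qed.

Lemma cts_dlaplacian i x : {for x, continuous (dlaplacian i)}.
Proof.
have c1 := @C2_cts_partial _ _ u uC2 i x.
apply: ctsD; last by apply: ctsM; first exact: cts_cst.
apply: ctsB.
  apply: ctsM; first exact: cts_cst.
  apply: ctsD => //; apply: cts_sum => k.
  by apply: ctsM; [exact: cts_coord|exact: C2_cts_partial2].
apply: ctsM => //; apply: ctsM; first exact: cts_cst.
by apply: (cts_upow sol); rewrite subr_gt0.
Qed.

Let v1 x : 1 <= 1 + u x. Proof. by rewrite lerDl. Qed.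
Let v0 x : 0 < 1 + u x. Proof. exact: lt_le_trans (v1 x). Qed.

Lemma is_derive_vpow q x i :
  is_derive x 'e_i (fun y => (1 + u y) `^ q) (q * (1 + u x) `^ (q - 1) * partial i u x).
Proof.
apply: (@is_derive_comp _ _ (fun s : R => s `^ q) (fun y => 1 + u y)).
  exact: is_derive1_powR.
rewrite -[X in is_derive _ _ _ X]add0r.
by apply: is_deriveDf; exact: C2_is_derive.
Qed.

Lemma cts_vpow q x : {for x, continuous (fun y => (1 + u y) `^ q)}.
Proof.
apply: (@cts_comp _ _ (fun s : R => s `^ q) (fun y => 1 + u y)).
  apply/differentiable_continuous; rewrite -derivable1_diffP.
  by have [] := is_derive1_powR q (v0 x).
by apply: ctsD; [exact: cts_cst|exact: C2_cts].
Qed.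

Lemma vpow_pred q x : (1 + u x) `^ (q - 1) = (1 + u x) `^ q / (1 + u x).
Proof.
rewrite powRB; first by rewrite powRr1 // ltW.
by rewrite [_ == 0]gt_eqF // implybT.
Qed.

Section Barrier.
Context (a c K r2 : R).
Local Notation s x := (r2 - sqnorm x).

(** Where [s = r2 - |x|^2 > 0], the inequality [|grad u|^2 <= barrier] says that
    [s^2 (v^(-a) |grad u|^2 + c v^(p+1-a)) <= K]. *)
Definition barrier x := K * (1 + u x) `^ a * (s x)^-1 ^+ 2 - c * (1 + u x) `^ (p + 1).

Definition barrier1 j x :=
  K * (a * (1 + u x) `^ (a - 1) * partial j u x * (s x)^-1 ^+ 2
       + (1 + u x) `^ a * (4 * x 0 j * (s x)^-1 ^+ 3))
  - c * ((p + 1) * (1 + u x) `^ p * partial j u x).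

Definition barrier2 j x :=
  K * (a * (((a - 1) * (1 + u x) `^ (a - 1 - 1) * partial j u x * partial j u x
             + (1 + u x) `^ (a - 1) * partial j (partial j u) x) * (s x)^-1 ^+ 2
            + (1 + u x) `^ (a - 1) * partial j u x * (4 * x 0 j * (s x)^-1 ^+ 3))
       + (a * (1 + u x) `^ (a - 1) * partial j u x * (4 * x 0 j * (s x)^-1 ^+ 3)
          + (1 + u x) `^ a * (4 * (s x)^-1 ^+ 3 + 24 * x 0 j ^+ 2 * (s x)^-1 ^+ 4)))
  - c * ((p + 1) * (p * (1 + u x) `^ (p - 1) * partial j u x * partial j u x
                    + (1 + u x) `^ p * partial j (partial j u) x)).

Lemma is_derive_cutoffV x j : s x != 0 ->
  is_derive x 'e_j (fun y => (s y)^-1) (2 * x 0 j * (s x)^-1 ^+ 2).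
Proof.
move=> sx; apply: is_derive_eq.
  apply: (@is_deriveVf (fun y => s y)) => //; apply: is_deriveBf; exact: is_derive_sqnorm.
by rewrite sub0r exprVn; ring.
Qed.

Lemma is_deriveXf (f : V -> R) x w d k : is_derive x w f d ->
  is_derive x w (fun y => f y ^+ k.+1) (k.+1%:R * f x ^+ k * d).
Proof.
move=> df; have -> : (fun y => f y ^+ k.+1) = f ^+ k.+1.
  by apply/funext => y; rewrite exprfctE.
by apply: is_derive_eq.
Qed.

Lemma is_derive_barrier j x : s x != 0 -> is_derive x 'e_j barrier (barrier1 j x).
Proof.
move=> sx; apply: is_derive_eq.
  apply: is_deriveBf; last by apply: is_deriveZf; exact: is_derive_vpow.
  apply: is_deriveMf; first by apply: is_deriveZf; exact: is_derive_vpow.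
  by apply: is_deriveXf; exact: is_derive_cutoffV.
by rewrite /barrier1 addrK; ring.
Qed.

Lemma is_derive_barrier1 j x : s x != 0 -> is_derive x 'e_j (barrier1 j) (barrier2 j x).
Proof.
move=> sx; apply: is_derive_eq.
  apply: is_deriveBf; apply: is_deriveZf.
    apply: is_deriveDf; apply: is_deriveMf.
    - apply: is_deriveMf; last exact: C2_is_derive_partial.
      by apply: is_deriveZf; exact: is_derive_vpow.
    - by apply: is_deriveXf; exact: is_derive_cutoffV.
    - exact: is_derive_vpow.
    - apply: is_deriveMf; first by apply: is_deriveZf; exact: is_derive_coord_basis.
      by apply: is_deriveXf; exact: is_derive_cutoffV.
  apply: is_deriveMf; last exact: C2_is_derive_partial.
  by apply: is_deriveZf; exact: is_derive_vpow.
by rewrite /barrier2 eqxx /=; ring.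
Qed.

Lemma cts_cutoffV x : s x != 0 -> {for x, continuous (fun y => (s y)^-1)}.
Proof.
move=> sx; apply: (cvgV (F := nbhs x)) => //.
by apply: (@ctsB _ _ (fun=> r2)); [exact: cts_cst|exact: cts_sqnorm].
Qed.

Lemma ctsX (f : V -> R) x k : {for x, continuous f} ->
  {for x, continuous (fun y => f y ^+ k)}.
Proof.
move=> cf; apply: (@cts_comp _ _ (fun t : R => t ^+ k)) => //.
exact: exprn_continuous.
Qed.

Lemma cts_barrier x : s x != 0 -> {for x, continuous barrier}.
Proof.
move=> sx; have cs := @ctsX _ _ 2 (cts_cutoffV sx).
apply: ctsB; first apply: (ctsM _ cs); apply: ctsM; try exact: cts_cst; exact: cts_vpow.
Qed.

Lemma cts_barrier2 j x : s x != 0 -> {for x, continuous (barrier2 j)}.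
Proof.
move=> sx; have cs k := @ctsX _ _ k (cts_cutoffV sx).
have c1 := @C2_cts_partial _ _ u uC2 j x; have c2 := @C2_cts_partial2 _ _ u uC2 j j x.
have cx := @cts_coord _ _ x j.
have k := fun t => @cts_cst R n t x; have cv q := @cts_vpow q x.
have e1 := ctsM (ctsM (ctsM (k (a - 1)) (cv (a - 1 - 1))) c1) c1.
have e2 := ctsM (ctsM (cv (a - 1)) c1) (ctsM (ctsM (k 4) cx) (cs 3%N)).
have e3 := ctsM (ctsM (ctsM (k a) (cv (a - 1))) c1)
               (ctsM (ctsM (k 4) cx) (cs 3%N)).
have e4 := ctsM (cv a) (ctsD (ctsM (k 4) (cs 3%N))
                           (ctsM (ctsM (k 24) (@ctsX _ _ 2 cx)) (cs 4%N))).
have e5 := ctsM (ctsM (ctsM (k p) (cv (p - 1))) c1) c1.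
have e6 := ctsD (ctsM (ctsD e1 (ctsM (cv (a - 1)) c2)) (cs 2%N)) e2.
have := ctsB (ctsM (k K) (ctsD (ctsM (k a) e6) (ctsD e3 e4)))
            (ctsM (k c) (ctsM (k (p + 1)) (ctsD e5 (ctsM (cv p) c2)))).
by apply.
Qed.

Lemma near_cutoff_gt0 x : 0 < s x -> \forall y \near x, 0 < s y.
Proof.
move=> sx; have cs : {for x, continuous (fun y => s y)}.
  by apply: (@ctsB _ _ (fun=> r2)); [exact: cts_cst|exact: cts_sqnorm].
exact: (cvgr_gt _ cs).
Qed.

(** Equality of the gradients, paired with [grad u] and with [x], computes the
    two Hessian terms; the ordering of the Laplacians then gives the inequality.
    The constant [K] disappears, since [K v^a / s^2] equals [|grad u|^2 + c
    v^(p+1)] at [x]. *)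
Lemma barrier_touching_inequality l x X xi m : (0 < n)%N -> 0 <= c -> 0 < s x ->
  (\forall y \near x, sqgrad u y <= barrier y) -> sqgrad u x = barrier x ->
  X = sqgrad u x / (1 + u x) ^+ 2 -> xi = radial_deriv u x / (1 + u x) ->
  m = (`|u x| `^ p - beta * u x) / (1 + u x) ->
  2 * (l * ((X + c * (1 + u x) `^ (p - 1)) * (a * X + 4 * xi / s x)
            - c * (p + 1) * (1 + u x) `^ (p - 1) * X)
         - l ^+ 2 * X ^+ 2 + (m + l * X - 2^-1 * xi) ^+ 2 / n%:R)
      - 2 * p * (1 + u x) `^ (p - 1) * X
    <= (X + c * (1 + u x) `^ (p - 1)) *
         (a * (a - 1) * X - a * m + 8 * a * xi / s x + 4 * n%:R / s x
           + 24 * sqnorm x / s x ^+ 2)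
       + c * (p + 1) * ((1 + u x) `^ (p - 1) * m - p * (1 + u x) `^ (p - 1) * X).
Proof.
move=> n0 c0 sx GB GBx XE xiE mE.
have nears := near_cutoff_gt0 sx.
have [H1 H2] := @bernstein_max R n u (fun i => partial i u)
   (fun i j => partial j (partial i u)) dlaplacian barrier barrier1 barrier2 x
   (@C2_cts _ _ u uC2) (fun i y => @C2_is_derive _ _ u uC2 i y)
   (fun i => @C2_cts_partial _ _ u uC2 i)
   (fun i j y => @C2_is_derive_partial _ _ u uC2 i j y)
   (fun i j => @C2_cts_partial2 _ _ u uC2 i j)
   (fun i y => @is_derive_laplacian y i) cts_dlaplacian
   (filterS (fun y (sy : 0 < s y) => @cts_barrier y (lt0r_neq0 sy)) nears)
   (fun j => filterS (fun y (sy : 0 < s y) => @is_derive_barrier j y (lt0r_neq0 sy)) nears)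
   (fun j => filterS (fun y (sy : 0 < s y) => @is_derive_barrier1 j y (lt0r_neq0 sy)) nears)
   (fun j => @cts_barrier2 j x (lt0r_neq0 sx)) GB GBx.
have vx0 := v0 x; have vn0 : 1 + u x != 0 by rewrite gt_eqF.
have sn0 : s x != 0 by rewrite gt_eqF.
set Y := (1 + u x) `^ (p - 1).
have vp : (1 + u x) `^ p = (1 + u x) * Y by rewrite mulr_powRB1 // ltW.
have vpp : (1 + u x) `^ (p + 1) = (1 + u x) ^+ 2 * Y.
  rewrite -(@mulr_powRB1 _ (1 + u x) (p + 1)) ?(ltW vx0) ?addr_gt0 // addrK vp.
  by rewrite mulrA.
pose T := sqgrad u x + c * ((1 + u x) ^+ 2 * Y).
have TE : T = K * (1 + u x) `^ a * (s x)^-1 ^+ 2.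
  by rewrite /T GBx /barrier vpp subrK.
have b1E j : barrier1 j x = T * (a * partial j u x / (1 + u x) + 4 * x 0 j / s x)
    - c * (p + 1) * ((1 + u x) * Y) * partial j u x.
  rewrite /barrier1 TE vp vpow_pred; move: (_ `^ a) => Va; field.
  by rewrite vn0 sn0.
have b2E j : barrier2 j x = T * (a * (a - 1) * partial j u x ^+ 2 / (1 + u x) ^+ 2
      + a * partial j (partial j u) x / (1 + u x)
      + 8 * a * (x 0 j * partial j u x) / (s x * (1 + u x)) + 4 / s x
      + 24 * x 0 j ^+ 2 / s x ^+ 2)
    - c * (p + 1) * (p * Y * partial j u x ^+ 2
                     + (1 + u x) * Y * partial j (partial j u) x).
  rewrite /barrier2 TE vp (vpow_pred (a - 1)) vpow_pred -/Y; move: (_ `^ a) => Va; field.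
  by rewrite vn0 sn0.
apply: (@touching_algebra R n%:R p a c l beta (1 + u x) (s x) (sqgrad u x) (radial_deriv u x)
  (laplacian u x)
  (\sum_j \sum_i partial j u x * (partial i u x * partial j (partial i u) x))
  (\sum_j \sum_i x 0 j * (partial i u x * partial j (partial i u) x))
  (\sum_j \sum_i partial j (partial i u) x ^+ 2)
  (sqnorm x) Y (`|u x| `^ (p - 1)) (`|u x| `^ p - beta * u x)) => //.
- by rewrite ltr0n.
- by apply: sumr_ge0 => i _; exact: sqr_ge0.
- exact: sqnorm_ge0.
- rewrite ger0_norm //; apply: ge0_ler_powR; rewrite ?nnegrE ?(ltW vx0) //.
    by rewrite subr_ge0 ltW.
  by rewrite lerDr.
- by rewrite divr_ge0 // subr_ge0 ltW.
- exact: powR_ge0.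
- by rewrite (laplacianE p1 u0 sol); ring.
- rewrite -/T mulr_sumr.
  transitivity (\sum_j partial j u x * barrier1 j x).
    by apply: eq_bigr => j _; rewrite -H1 -mulr_sumr; ring.
  transitivity (\sum_j ((T * a / (1 + u x) - c * (p + 1) * ((1 + u x) * Y))
        * partial j u x ^+ 2
      + 4 * T / s x * (x 0 j * partial j u x))).
    by apply: eq_bigr => j _; rewrite b1E; ring.
  rewrite big_split /= -!mulr_sumr -/(sqgrad u x) -/(radial_deriv u x); ring.
- rewrite -/T mulr_sumr.
  transitivity (\sum_j x 0 j * barrier1 j x).
    by apply: eq_bigr => j _; rewrite -H1 -mulr_sumr; ring.
  transitivity (\sum_j ((T * a / (1 + u x) - c * (p + 1) * ((1 + u x) * Y))
        * (x 0 j * partial j u x)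
      + 4 * T / s x * (x 0 j ^+ 2))).
    by apply: eq_bigr => j _; rewrite b1E; ring.
  rewrite big_split /= -!mulr_sumr -/(sqnorm x) -/(radial_deriv u x); ring.
- exact: (@hessian_lower R n (fun i j => partial j (partial i u) x) (fun i => partial i u x)).
rewrite -/T.
have -> : sqgrad u x + \sum_j \sum_i x 0 j * (partial i u x * partial j (partial i u) x) -
   2 * (p * `|u x| `^ (p - 1) - beta) * sqgrad u x = 2 * \sum_i partial i u x * dlaplacian i x.
  have -> : \sum_i partial i u x * dlaplacian i x = \sum_i
     ((2^-1 - p * `|u x| `^ (p - 1) + beta) * partial i u x ^+ 2
      + 2^-1 * (\sum_k x 0 k * (partial i u x * partial k (partial i u) x))).
    apply: eq_bigr => i _; rewrite /dlaplacian.
    have -> : \sum_k x 0 k * (partial i u x * partial k (partial i u) x)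
       = partial i u x * \sum_k x 0 k * partial i (partial k u) x.
      rewrite mulr_sumr; apply: eq_bigr => k _.
      by rewrite (C2_partial_sym uC2 i k); ring.
    ring.
  rewrite big_split /= -!mulr_sumr -/(sqgrad u x) [in RHS]exchange_big /=.
  by move: (beta) => B; field.
apply: (le_trans H2); rewrite le_eqVlt; apply/orP; left; apply/eqP.
transitivity (\sum_j ((T * a * (a - 1) / (1 + u x) ^+ 2 - c * (p + 1) * p * Y) * partial j u x ^+ 2
   + (T * a / (1 + u x) - c * (p + 1) * ((1 + u x) * Y)) * partial j (partial j u) x
   + 8 * T * a / (s x * (1 + u x)) * (x 0 j * partial j u x)
   + 4 * T / s x + 24 * T / s x ^+ 2 * x 0 j ^+ 2)).
  by apply: eq_bigr => j _; rewrite b2E; ring.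
rewrite !big_split /= -!mulr_sumr sumr_const card_ord -mulr_natr.
rewrite -/(sqgrad u x) -/(radial_deriv u x) -/(sqnorm x) -/(laplacian u x); ring.
Qed.
End Barrier.
End Touching.

(** * Polynomial growth and conclusion *)

Section Growth.
Context {R : realType} {n : nat}.
Local Notation V := 'rV[R]_n.
Implicit Types (x y v w : V) (t h : R).

Context (p : R) (u : V -> R).
Hypotheses (p1 : 1 < p) (u0 : forall x, 0 <= u x).
Hypothesis sol : classical_solution p (1 / (p - 1)) u.
Local Notation beta := (1 / (p - 1)).
Let uC2 : C2 u. Proof. by case: sol. Qed.
Let v1 x : 1 <= 1 + u x. Proof. by rewrite lerDl. Qed.
Let v0 x : 0 < 1 + u x. Proof. exact: lt_le_trans (v1 x). Qed.
Let E0 x : 0 <= sqgrad u x. Proof. by apply: sumr_ge0 => i _; exact: sqr_ge0. Qed.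

Lemma sublevel_compact (r2 : R) : compact [set y : V | sqnorm y <= r2].
Proof.
apply: bounded_closed_compact.
  exists (1 + r2); split; first exact: num_real.
  move=> M HM y /= yr; have := norm_sqnorm_le y; have := sqr_ge0 (`|y| - 1).
  nra.
have -> : [set y : V | sqnorm y <= r2] = (@sqnorm R n) @^-1` [set t | t <= r2] by [].
by apply: closed_comp => [y _|]; [exact: cts_sqnorm|exact: closed_le].
Qed.

Definition bernstein_fun a c x :=
  (1 + u x) `^ (- a) * sqgrad u x + c * (1 + u x) `^ (p + 1 - a).

(** To estimate at [y], maximise [s^2] times the Bernstein function over the
    ball of radius [r] with [r^2 = 2 (1 + |y|^2)]; then [s] is comparable to
    [r^2] at [y]. Since [a >= 2] and [v >= 1], the Bernstein function is at most
    a multiple of [X + Y], so the bound at the maximum transfers to [y]. *)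
Lemma bernstein_estimate a c l : (0 < n)%N -> good_exponents n%:R p a c l ->
  exists2 C : R, 0 <= C & forall y, bernstein_fun a c y <= C * (1 + sqnorm y).
Proof.
move=> n0 good; have N0 : 0 < n%:R :> R by rewrite ltr0n.
have [a2 b0 c0 l0 _] := good.
have be0 : 0 <= beta by rewrite divr_ge0 // subr_ge0 ltW.
have [d d01 Hd] := bernstein_algebra N0 good.
have [Cr Cr0 HCr] := reaction_lower p1 be0 d01.
have [C0 C00 HC0] := Hd _ Cr0.
exists (8 * (1 + c) * C0); first by rewrite !mulr_ge0 //; lra.
move=> y.
pose r := Num.sqrt (2 * (1 + sqnorm y)).
have sq1 : 1 <= 1 + sqnorm y by exact: sqnorm_ge1.
have rr : r ^+ 2 = 2 * (1 + sqnorm y) by rewrite sqr_sqrtr //; lra.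
have r0 : 0 <= r by exact: sqrtr_ge0.
have r1 : 1 <= r by nra.
pose s (z : V) := r ^+ 2 - sqnorm z.
pose F (z : V) := s z ^+ 2 * bernstein_fun a c z.
have P0 z : 0 < bernstein_fun a c z.
  by rewrite ltr_wpDl ?mulr_ge0 ?powR_ge0 // mulr_gt0 // powR_gt0.
have cF : {within [set z : V | sqnorm z <= r ^+ 2], continuous F}.
  apply: continuous_subspaceT => z.
  apply: ctsM.
    apply: ctsX; apply: ctsB; [exact: cts_cst|exact: cts_sqnorm].
  apply: ctsD; apply: ctsM; [|exact: (cts_sqgrad sol)|exact: cts_cst|].
    exact: (cts_vpow u0 sol).
  exact: (cts_vpow u0 sol).
have By : sqnorm y <= r ^+ 2 by have := sqnorm_ge0 y; lra.
have [x xB Fx] := compact_EVT_max (ex_intro _ y By) (@sublevel_compact (r ^+ 2)) cF.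
rewrite inE /= in xB.
have sy : (1 + sqnorm y) <= s y by rewrite /s rr; lra.
have Fy : 0 < F y by rewrite mulr_gt0 // exprn_gt0 //; lra.
have Fyx : F y <= F x by apply: Fx; rewrite inE.
have sx : 0 < s x.
  rewrite lt_neqAle subr_ge0 xB andbT eq_sym; apply/eqP => sx0.
  by move: Fyx; rewrite /F sx0 expr0n mul0r leNgt Fy.
have energyE z : sqgrad u z = bernstein_fun a c z * (1 + u z) `^ a
    - c * (1 + u z) `^ (p + 1).
  rewrite /bernstein_fun powRN mulrDl -mulrA [sqgrad u z * _]mulrC mulrA mulVf ?mul1r; last first.
    by rewrite gt_eqF // powR_gt0.
  rewrite -mulrA -powRD ?subrK ?addrK //.
  by apply/implyP => _; rewrite gt_eqF.
have barE z : 0 < s z -> F z <= F x -> sqgrad u z <= barrier p u a c (F x) (r ^+ 2) z.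
  move=> sz Fzx; rewrite energyE /barrier -/(s z) lerD2r mulrAC ler_wpM2r ?powR_ge0 //.
  by rewrite exprVn ler_pdivlMr ?exprn_gt0 // mulrC.
pose X := sqgrad u x / (1 + u x) ^+ 2.
pose xi := radial_deriv u x / (1 + u x).
pose m := (`|u x| `^ p - beta * u x) / (1 + u x).
pose Y := (1 + u x) `^ (p - 1).
have X0 : 0 <= X by rewrite divr_ge0 // exprn_ge0 // ltW.
have Y0 : 0 <= Y by exact: powR_ge0.
have touch := @barrier_touching_inequality R n p u p1 u0 sol a c (F x)
  (r ^+ 2) l x X xi m n0 (ltW c0) sx.
have {}touch := touch _ _ erefl erefl erefl.
have nearx : \forall z \near x, sqgrad u z <= barrier p u a c (F x) (r ^+ 2) z.
  apply: filterS (near_cutoff_gt0 sx) => z sz; apply: barE => //.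
  by apply: Fx; rewrite inE /= -subr_ge0 ltW.
have eqx : sqgrad u x = barrier p u a c (F x) (r ^+ 2) x.
  rewrite energyE /barrier -/(s x) /F; congr (_ - _); field.
  by rewrite gt_eqF.
have {}touch := touch nearx eqx.
have mE : m = ((1 + u x - 1) `^ p - beta * (1 + u x - 1)) / (1 + u x).
  by rewrite /m ger0_norm // [1 + u x - 1]addrAC subrr add0r.
have key : s x ^+ 2 * (X + Y) <= C0 * r ^+ 6.
  apply: (HC0 r (s x) (sqnorm x) X Y xi m) => //.
  - by rewrite /s; have := sqnorm_ge0 x; lra.
  - exact: sqnorm_ge0.
  - rewrite /xi /X expr_div_n mulrA ler_wpM2r ?invr_ge0 ?sqr_ge0 //.
    exact: (@cauchy_schwarz R n (fun k => x 0 k) (fun k => partial k u x)).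
  - by rewrite mE; exact: HCr.
  - rewrite /m ler_pdivrMr // /Y [_ * (1 + u x)]mulrC mulr_powRB1 ?(ltW (v0 x)) //; last first.
      exact: lt_trans p1.
    have h1 : `|u x| `^ p <= (1 + u x) `^ p.
      rewrite ger0_norm //; apply: ge0_ler_powR; rewrite ?nnegrE ?(ltW (v0 x)) ?lerDr //.
      by apply: ltW; exact: lt_trans p1.
    have h2 : 0 <= beta * u x by rewrite mulr_ge0.
    lra.
have Pxy : bernstein_fun a c x <= (1 + c) * (X + Y).
  have h1 : (1 + u x) `^ (- a) * sqgrad u x <= X.
    rewrite mulrC /X powRN ler_wpM2l // lef_pV2 ?posrE ?exprn_gt0 ?powR_gt0 //.
    by rewrite -powR_mulrn ?(ltW (v0 x)) //; apply: ler_powR.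
  have h2 : (1 + u x) `^ (p + 1 - a) <= Y by apply: ler_powR => //; lra.
  have h3 : c * (1 + u x) `^ (p + 1 - a) <= c * Y by rewrite ler_pM2l.
  have h4 : 0 <= c * X by rewrite mulr_ge0 // ltW.
  rewrite /bernstein_fun; lra.
have Fx6 : F x <= (1 + c) * (C0 * r ^+ 6).
  apply: (@le_trans _ _ ((1 + c) * (s x ^+ 2 * (X + Y)))); last first.
    by rewrite ler_wpM2l //; lra.
  by rewrite mulrCA /F ler_wpM2l // sqr_ge0.
pose q := 1 + sqnorm y.
have q0 : 0 < q by rewrite /q; lra.
have : q ^+ 2 * bernstein_fun a c y <= q ^+ 2 * (8 * (1 + c) * C0 * q).
  apply: (@le_trans _ _ (F y)).
    rewrite /F ler_wpM2r ?(ltW (P0 y)) // ler_sqr ?nnegrE ?(ltW q0) //.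
    by apply: le_trans sy; exact: ltW.
  apply: (le_trans Fyx); apply: (le_trans Fx6).
  have -> : r ^+ 6 = (2 * q) ^+ 3 by rewrite -rr -exprM.
  by rewrite le_eqVlt; apply/orP; left; apply/eqP; ring.
by rewrite ler_pM2l // exprn_gt0.
Qed.

(** The two terms of the Bernstein function are bounded separately: the second
    controls [v], as its exponent is positive, and then the first controls the
    gradient. *)
Lemma solution_polygrowth a c l : (0 < n)%N -> good_exponents n%:R p a c l ->
  polygrowth u /\ forall i, polygrowth (partial i u).
Proof.
move=> n0 good; have [C C0 HC] := bernstein_estimate n0 good.
have [a2 b0 c0 l0 _] := good.
pose b := p + 1 - a.
have grow1 (D : R) : polygrowth (fun x : V => D * (1 + sqnorm x)).
  apply: polygrowthM; first exact: polygrowth_cst.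
  apply: polygrowthD; first exact: polygrowth_cst.
  by apply: polygrowth_sum => k; apply: polygrowthX; exact: polygrowth_coord.
have growv : polygrowth (fun x => 1 + u x).
  pose k := (Num.truncn b^-1).+1.
  apply: (@polygrowth_le _ _ _ (fun x => ((C / c + 1) * (1 + sqnorm x)) ^+ k)); last exact: polygrowthX.
  move=> x; pose W := (C / c + 1) * (1 + sqnorm x).
  have Cc : 0 <= C / c by rewrite divr_ge0 // ltW.
  have sq1 := sqnorm_ge1 x.
  have W1 : 1 <= W by rewrite /W; nra.
  have W0 : 0 <= W by lra.
  rewrite -/W (ger0_norm (ltW (v0 x))) ger0_norm ?exprn_ge0 //.
  have vb : (1 + u x) `^ b <= W.
    have h : c * (1 + u x) `^ b <= C * (1 + sqnorm x).
      apply: le_trans (HC x); rewrite lerDr mulr_ge0 ?powR_ge0 //.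
    have : (1 + u x) `^ b <= C * (1 + sqnorm x) / c by rewrite ler_pdivlMr // mulrC.
    rewrite /W; lra.
  have -> : 1 + u x = ((1 + u x) `^ b) `^ b^-1.
    by rewrite -powRrM mulfV ?gt_eqF // powRr1 // ltW.
  apply: (@le_trans _ _ (W `^ b^-1)).
    apply: ge0_ler_powR; rewrite ?nnegrE ?powR_ge0 // invr_ge0 ltW //.
  rewrite -powR_mulrn //; apply: ler_powR => //.
  exact/ltW/truncnS_gt.
have growE : polygrowth (sqgrad u).
  pose k := (Num.truncn a).+1.
  apply: (@polygrowth_le _ _ _ (fun x => (C * (1 + sqnorm x)) * (1 + u x) ^+ k)); last first.
    by apply: polygrowthM => //; exact: polygrowthX.
  move=> x; have sq1 := sqnorm_ge1 x.
  have h0 : 0 <= C * (1 + sqnorm x) by rewrite mulr_ge0 //; lra.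
  rewrite (ger0_norm (E0 x)) ger0_norm; last by apply: mulr_ge0 => //; rewrite exprn_ge0 // ltW.
  have h : (1 + u x) `^ (- a) * sqgrad u x <= C * (1 + sqnorm x).
    apply: le_trans (HC x); rewrite lerDl mulr_ge0 ?powR_ge0 // ltW //.
  apply: (@le_trans _ _ (C * (1 + sqnorm x) * (1 + u x) `^ a)).
    by rewrite -ler_pdivrMr ?powR_gt0 // -powRN mulrC.
  rewrite ler_wpM2l // -powR_mulrn ?(ltW (v0 x)) //; apply: ler_powR => //.
  exact/ltW/truncnS_gt.
split.
  apply: polygrowth_le growv => x; rewrite !ger0_norm ?(ltW (v0 x)) // lerDr //.
move=> i; apply: (@polygrowth_le _ _ _ (fun x => 1 + sqgrad u x)).
  move=> x; rewrite [leRHS]ger0_norm ?addr_ge0 //.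
  have : partial i u x ^+ 2 <= sqgrad u x.
    by rewrite /sqgrad (bigD1 i) //= lerDl sumr_ge0 // => j _; exact: sqr_ge0.
  rewrite -[_ ^+ 2]real_normK ?num_real // => h.
  have := sqr_ge0 (`|partial i u x| - 1); nra.
by apply: polygrowthD => //; exact: polygrowth_cst.
Qed.
End Growth.

(** For [n >= 3] this is the inequality [p (n - 2) < n + 2] divided by [2 (p +
    1)]. *)
Lemma subcritical_coeff (R : realType) (n : nat) (p : R) :
  1 < p -> (p%:E < p_star R n)%E -> 0 < 1 - n%:R / 2 + n%:R * (p + 1)^-1.
Proof.
move=> p1; have p10 : 0 < p + 1 by rewrite addr_gt0 // (lt_trans ltr01).
have pV : 0 < (p + 1)^-1 by rewrite invr_gt0.
rewrite /p_star; case: leqP => [n2 _|n3].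
  have n2' : n%:R <= 2 :> R by rewrite ler_nat.
  case: n n2 n2' => [|n] n2 n2'; first by rewrite mul0r; lra.
  have : 0 < n.+1%:R * (p + 1)^-1 by rewrite mulr_gt0.
  lra.
have n3' : 3 <= n%:R :> R by rewrite ler_nat.
rewrite lte_fin ltr_pdivlMr; last by lra.
move=> h; have -> : 1 - n%:R / 2 + n%:R * (p + 1)^-1
   = (n%:R + 2 - p * (n%:R - 2)) / (2 * (p + 1)).
  by field; rewrite gt_eqF.
by rewrite divr_gt0 ?mulr_gt0 //; lra.
Qed.

Theorem theorem1p2 (R : realType) (n : nat) (p : R) (u : 'rV[R]_n -> R) :
  (1 <= n)%N ->
  1 < p -> (p%:E < p_star R n)%E ->
  let beta := 1 / (p - 1) in
  (forall x, 0 <= u x) ->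
  classical_solution p beta u ->
  forall x, enorm (grad u x) = 0.
Proof.
move=> n0 p1 pp beta u0 sol x.
have [a [c [l good]]] := exist_good_exponents n0 p1 pp.
have [pu pu1] := solution_polygrowth p1 u0 sol n0 good.
have := pohozaev_rigidity p1 u0 sol n0 (subcritical_coeff p1 pp) pu pu1 x.
rewrite /enorm => E.
have -> : dotv (grad u x) (grad u x) = sqgrad u x.
  by apply: eq_bigr => i _; rewrite !mxE expr2.
by rewrite E sqrtr0.
Qed.
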